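(* Let $W$ be a smooth, non-negative function on $\mathbb{R}$ supported on $[0,1]$, and let $\{\lambda_n\}_{n=1}^\infty$ be a sequence of real numbers with $\lambda_n\to 0$. If the sequence of positive numbers $\{N_n\}_{n=1}^\infty$ is sufficiently sparse (in the sense defined in the context), then for the half-line Schrödinger operator $H=-\frac{d^2}{dx^2}+V$ on $L^2(\mathbb{R}^+)$ with Neumann boundary conditions at $0$ and potential $$V(x)=\sum_{n=1}^\infty \lambda_n W(x-N_n),$$ the associated continuous Christoffel–Darboux kernel $S_L$ satisfies $$\lim_{L\to\infty}\frac{S_L\left(\xi+\frac{a}{L},\xi+\frac{b}{L}\right)}{S_L(\xi,\xi)}=\frac{\sin\left(\pi\rho(\xi)(b-a)\right)}{\pi\rho(\xi)(b-a)},\qquad \rho(\xi)=\frac{1}{2\pi\sqrt{\xi}},$$ uniformly for $\xi$ in compact subsets of $(0,\infty)$ and $a,b$ in compact subsets of the strip $\{z\in\mathbb{C}:|\operatorname{Im}z|\le 1\}$ (the right-hand side is understood to be $1$ when $a=b$).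
   Context: ''$\{N_n\}$ is sufficiently sparse'' means that $N_{k+1}$ has to be chosen sufficiently large as a function of $N_1,\dots,N_k$. Precisely, the theorem asserts that, given $W$ and $\{\lambda_n\}$, there exist functions $\widetilde N_k(N_1,\dots,N_k)$, $k\ge 1$, such that the conclusion holds for every sequence of positive numbers $\{N_n\}$ with $N_{k+1}\ge \widetilde N_k(N_1,\dots,N_k)$ for all $k\ge1$. In particular, sparseness includes the requirement $N_k/N_{k+1}\to 0$. For $\xi\in\mathbb{C}$, $u(\xi,x)$ denotes the unique solution of $-\frac{d^2}{dx^2}u(\xi,x)+V(x)u(\xi,x)=\xi\,u(\xi,x)$ on $[0,\infty)$ with $u(\xi,0)=1$ and $u'(\xi,0)=0$ (prime denotes $d/dx$). The continuous Christoffel–Darboux kernel at $L>0$ is $$S_L(\xi,\zeta)=\int_0^L u(\xi,r)\,u(\zeta,r)\,dr .$$ The function $\rho(\xi)=\frac{1}{2\pi}\xi^{-1/2}$ is the density of states of the free operator $-\frac{d^2}{dx^2}$, which is also the density of states of $H$. *)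

(* Defs.v *)
From Stdlib Require Import Reals List.
From Coquelicot Require Import Coquelicot.
Open Scope R_scope.

Definition smooth (W : R -> R) : Prop :=
  forall (n : nat) (x : R), ex_derive_n W n x.

(* Sequences indexed from 1 in the mathematics are indexed from 0 here:
   [lam n] and [N n] stand for lambda_{n+1} and N_{n+1}. *)

Definition potential (W : R -> R) (lam N : nat -> R) (x : R) : R :=
  Series (fun n => lam n * W (x - N n)).

(* The family Ntilde_k (N_1, ..., N_k), k >= 1, is a single function on lists;
   the length of the list is k. *)
Definition sparse (Ntilde : list R -> R) (N : nat -> R) : Prop :=
  forall k : nat, Ntilde (map N (seq 0 (S k))) <= N (S k).

(* Derivative relative to the half-line [0, oo): one-sided at 0 and the usual
   derivative at x > 0; values of f on (-oo, 0) play no role. *)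
Definition is_derive_half_line (f : R -> C) (x : R) (l : C) : Prop :=
  @filterdiff R_AbsRing (AbsRing_NormedModule R_AbsRing) C_R_NormedModule
    f (within (fun y : R => 0 <= y) (locally x))
    (fun h : R => @scal R_AbsRing C_R_NormedModule h l).

Definition neumann_solution (V : R -> R) (xi : C) (u : R -> C) : Prop :=
  exists u1 u2 : R -> C,
    (forall x : R, 0 <= x -> is_derive_half_line u x (u1 x)) /\
    (forall x : R, 0 <= x -> is_derive_half_line u1 x (u2 x)) /\
    (forall x : R, 0 <= x ->
       (- u2 x + RtoC (V x) * u x)%C = (xi * u x)%C) /\
    u 0 = RtoC 1 /\ u1 0 = RtoC 0.

Definition CD_kernel (u : C -> R -> C) (L : R) (xi zeta : C) : C :=
  @RInt C_R_CompleteNormedModule (fun r : R => (u xi r * u zeta r)%C) 0 L.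

Definition density (xi : R) : R := 1 / (2 * PI * sqrt xi).

Definition Cexp (z : C) : C :=
  (RtoC (exp (Re z)) * (cos (Im z), sin (Im z)))%C.

Definition Csin (z : C) : C :=
  ((Cexp (Ci * z) - Cexp (- (Ci * z))) / (RtoC 2 * Ci))%C.

Definition Csinc (z : C) : C :=
  if Ceq_dec z (RtoC 0) then RtoC 1 else (Csin z / z)%C.

Definition Ccompact (K : C -> Prop) : Prop :=
  forall F : (C -> Prop) -> Prop,
    (forall U, F U -> open U) ->
    (forall z, K z -> exists U, F U /\ U z) ->
    exists l : list (C -> Prop),
      (forall U, In U l -> F U) /\
      (forall z, K z -> exists U, In U l /\ U z).

(* Main.v *)
Require Import Defs.
From Stdlib Require Import Reals List Arith Lra Lia Classical.
From Coquelicot Require Import Coquelicot.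
Open Scope R_scope.

(** Why the theorem holds.  Let L lie between two consecutive bump positions,
    N_k <= L < N_(k+1) in zero-based indexing with k >= 1, and put
    T = N_(k-1) + 2.  On [T,L] the potential is the single bump
    lambda_k W(x - N_k), which has small total mass, and T is tiny compared
    with L, since sparseness makes L at least exp(k T).  Write xi = s^2.

    - On [0,T] a Gronwall bound for the energy s^2 |u|^2 + |u'|^2 shows that
      every solution involved, and the reciprocal of the energy of the
      unperturbed real solution u_0 (energy parameter xi), is O(e^(cT)).
      Moving the energy parameter by a/L changes the solution on [0,T] by
      O(e^(c'T)/L) in the squared energy norm; because c and c' are fixed and k
      grows, this is negligible even relative to the energy of u_0 at T.

    - On [T,L] the solution u_a for xi + a/L is therefore close to the free
      wave w_a with the data of u_0 at T and with the frequency
      kappa_a = s + a/(2sL).  This frequency is a rational substitute for the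
      square root of xi + a/L: its square is off by only a^2/(4 s^2 L^2), whose
      integral over [0,L] tends to 0.  The bump contributes O(|lambda_k|)
      to the squared relative error (lemma [approximation]).

    - With (alpha, beta) = (u_0(T), u_0'(T)/s), which are real, and
      y = x - T, the product w_a w_b is the sum of
      (alpha^2 + beta^2)/2 * cos((kappa_b - kappa_a) y) and of terms that
      oscillate with frequency kappa_a + kappa_b, which stays away from 0 and
      makes their integrals bounded.  As (kappa_b - kappa_a) L = (b - a)/(2s),
      the first term integrates over [0,L] to M sinc((b - a)/(2s)) with
      M = (alpha^2 + beta^2) L/2, and (b - a)/(2s) = pi rho(xi) (b - a).

    So S_L(xi + a/L, xi + b/L) = M (sinc(pi rho(xi) (b - a)) + o(1)) uniformly
    (lemma [kernel_estimate]), in particular S_L(xi, xi) = M (1 + o(1)), and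
    the amplitude M cancels in the quotient.  All constants depend only on a
    positive lower bound of s, a bound for |a| and |b|, the supremum of |V| and
    the integral of W, so one explicit threshold exp(k (N_k + 2)) for
    N_(k+1), in the one-based indexing, serves all compact sets at once. *)

(** * Calculus of complex-valued functions of a real variable *)

(** Splitting into the two real components reduces complex-valued calculus to
    derivatives, mean values and integrals of real functions. *)
Definition cderiv (f : R -> C) (x : R) (l : C) : Prop :=
  is_derive (fun t => Re (f t)) x (Re l) /\ is_derive (fun t => Im (f t)) x (Im l).

Lemma C_eq (z w : C) : Re z = Re w -> Im z = Im w -> z = w.
Proof. destruct z, w; simpl; intros; subst; reflexivity. Qed.

Lemma cderiv_val (f : R -> C) (x : R) (l l' : C) :
  l = l' -> cderiv f x l -> cderiv f x l'.
Proof. now intros ->. Qed.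

Lemma cderiv_ext_loc (f g : R -> C) (x : R) (l : C) :
  locally x (fun t => f t = g t) -> cderiv f x l -> cderiv g x l.
Proof.
  intros E [H1 H2]; split.
  - apply is_derive_ext_loc with (2 := H1); revert E; apply filter_imp; now intros t ->.
  - apply is_derive_ext_loc with (2 := H2); revert E; apply filter_imp; now intros t ->.
Qed.

Lemma cderiv_ext (f g : R -> C) (x : R) (l : C) :
  (forall t, f t = g t) -> cderiv f x l -> cderiv g x l.
Proof. intros E; apply cderiv_ext_loc, filter_forall, E. Qed.

Lemma cderiv_const (c : C) (x : R) : cderiv (fun _ => c) x 0.
Proof. split; apply @is_derive_const. Qed.

Lemma cderiv_plus (f g : R -> C) (x : R) (l m : C) :
  cderiv f x l -> cderiv g x m -> cderiv (fun t => f t + g t)%C x (l + m)%C.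
Proof.
  intros [H1 H2] [H3 H4]; split.
  - exact (is_derive_plus _ _ _ _ _ H1 H3).
  - exact (is_derive_plus _ _ _ _ _ H2 H4).
Qed.

Lemma cderiv_mult (f g : R -> C) (x : R) (l m : C) :
  cderiv f x l -> cderiv g x m ->
  cderiv (fun t => f t * g t)%C x (l * g x + f x * m)%C.
Proof.
  intros [H1 H2] [H3 H4]; split.
  - apply (is_derive_ext
      (fun t => minus (Re (f t) * Re (g t)) (Im (f t) * Im (g t)))); [easy|].
    evar_last.
    + apply (is_derive_minus (V := R_NormedModule));
        [apply (is_derive_mult (K := R_AbsRing) _ _ _ _ _ H1 H3 Rmult_comm)
        |apply (is_derive_mult (K := R_AbsRing) _ _ _ _ _ H2 H4 Rmult_comm)].
    + unfold minus, plus, opp, mult; simpl. unfold Re, Im; simpl; ring.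
  - apply (is_derive_ext
      (fun t => plus (Re (f t) * Im (g t)) (Im (f t) * Re (g t)))); [easy|].
    evar_last.
    + apply (is_derive_plus (V := R_NormedModule));
        [apply (is_derive_mult (K := R_AbsRing) _ _ _ _ _ H1 H4 Rmult_comm)
        |apply (is_derive_mult (K := R_AbsRing) _ _ _ _ _ H2 H3 Rmult_comm)].
    + unfold minus, plus, opp, mult; simpl. unfold Re, Im; simpl; ring.
Qed.

Lemma cderiv_scal (c : C) (f : R -> C) (x : R) (l : C) :
  cderiv f x l -> cderiv (fun t => c * f t)%C x (c * l)%C.
Proof.
  intros H. apply cderiv_val with (2 := cderiv_mult _ _ x _ _ (cderiv_const c x) H).
  ring.
Qed.

Lemma cderiv_minus (f g : R -> C) (x : R) (l m : C) :
  cderiv f x l -> cderiv g x m -> cderiv (fun t => f t - g t)%C x (l - m)%C.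
Proof.
  intros H1 H2. apply cderiv_ext with (fun t => f t + (-1) * g t)%C.
  { intros; ring. }
  apply cderiv_val with (l + (-1) * m)%C; [ring|].
  apply cderiv_plus; [easy|now apply cderiv_scal].
Qed.

Lemma cderiv_shift (f : R -> C) (a x : R) (l : C) :
  cderiv f (x - a) l -> cderiv (fun t => f (t - a)) x l.
Proof.
  intros [H1 H2]; split.
  - evar_last; [apply (is_derive_comp (fun t => Re (f t)) (fun t => t - a))|].
    + exact H1.
    + auto_derive; [easy|reflexivity].
    + unfold scal; simpl; unfold mult; simpl; ring.
  - evar_last; [apply (is_derive_comp (fun t => Im (f t)) (fun t => t - a))|].
    + exact H2.
    + auto_derive; [easy|reflexivity].
    + unfold scal; simpl; unfold mult; simpl; ring.
Qed.

Lemma cderiv_continuous (f : R -> C) (x : R) (l : C) :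
  cderiv f x l ->
  continuous (fun t => Re (f t)) x /\ continuous (fun t => Im (f t)) x.
Proof.
  intros [H1 H2]; split; apply @ex_derive_continuous; eexists; eassumption.
Qed.

Lemma Cexp_plus (z w : C) : Cexp (z + w) = (Cexp z * Cexp w)%C.
Proof.
  unfold Cexp. apply C_eq; unfold Re, Im; simpl; rewrite exp_plus, cos_plus, sin_plus; ring.
Qed.

Lemma Cexp_0 : Cexp 0 = 1.
Proof.
  unfold Cexp; apply C_eq; unfold Re, Im; simpl; rewrite exp_0, cos_0, sin_0; ring.
Qed.

Lemma Cmod_Cexp (z : C) : Cmod (Cexp z) = exp (Re z).
Proof.
  unfold Cexp. rewrite Cmod_mult, Cmod_R, (Rabs_pos_eq (exp _)) by (left; apply exp_pos).
  replace (Cmod _) with 1; [ring|].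
  rewrite <- sqrt_1 at 1. unfold Cmod; f_equal; simpl.
  generalize (sin2_cos2 (Im z)); unfold Rsqr; lra.
Qed.

Lemma cderiv_Cexp (c : C) (x : R) :
  cderiv (fun t => Cexp (c * t)) x (c * Cexp (c * x))%C.
Proof.
  unfold Cexp; split; unfold Re, Im; simpl.
  - auto_derive; [easy|]; unfold Re, Im; simpl. unfold Rminus; ring.
  - auto_derive; [easy|]; unfold Re, Im; simpl. unfold Rminus; ring.
Qed.

Definition Ccos (z : C) : C := ((Cexp (Ci * z) + Cexp (- (Ci * z))) / RtoC 2)%C.

Lemma two_neq_0 : RtoC 2 <> 0.
Proof. intros H; apply RtoC_inj in H; lra. Qed.

Lemma Ci_neq_0 : Ci <> 0.
Proof. intros H; apply (f_equal Im) in H; simpl in H; lra. Qed.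

Lemma Ci2 : (Ci * Ci = -1)%C.
Proof. apply C_eq; simpl; ring. Qed.

Lemma cderiv_Ccos (c : C) (x : R) :
  cderiv (fun t => Ccos (c * t)) x (- c * Csin (c * x))%C.
Proof.
  apply cderiv_ext with (fun t => / RtoC 2 * (Cexp ((Ci * c) * t) + Cexp ((- (Ci * c)) * t)))%C.
  { intros t; unfold Ccos.
    replace (- (Ci * (c * t)))%C with (- (Ci * c) * t)%C by ring.
    replace (Ci * (c * t))%C with (Ci * c * t)%C by ring.
    field. }
  eapply cderiv_val; [|apply cderiv_scal, cderiv_plus; apply cderiv_Cexp].
  unfold Csin.
  replace (- (Ci * (c * x)))%C with (- (Ci * c) * x)%C by ring.
  replace (Ci * (c * x))%C with (Ci * c * x)%C by ring.
  assert (E : (-1 / Ci = Ci)%C) by (rewrite <- Ci2; field; apply Ci_neq_0).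
  transitivity (/ 2 * c * Ci * (Cexp (Ci * c * x) - Cexp (- (Ci * c) * x)))%C; [ring|].
  rewrite <- E at 1. field. apply Ci_neq_0.
Qed.

Lemma cderiv_Csin (c : C) (x : R) :
  cderiv (fun t => Csin (c * t)) x (c * Ccos (c * x))%C.
Proof.
  apply cderiv_ext with (fun t => / (RtoC 2 * Ci) * (Cexp ((Ci * c) * t) - Cexp ((- (Ci * c)) * t)))%C.
  { intros t; unfold Csin.
    replace (- (Ci * (c * t)))%C with (- (Ci * c) * t)%C by ring.
    replace (Ci * (c * t))%C with (Ci * c * t)%C by ring.
    field. apply Ci_neq_0. }
  eapply cderiv_val; [|apply cderiv_scal, cderiv_minus; apply cderiv_Cexp].
  unfold Ccos.
  replace (- (Ci * (c * x)))%C with (- (Ci * c) * x)%C by ring.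
  replace (Ci * (c * x))%C with (Ci * c * x)%C by ring.
  field. apply Ci_neq_0.
Qed.

Lemma Ccos_0 : Ccos 0 = 1.
Proof.
  unfold Ccos. replace (- (Ci * 0))%C with (RtoC 0) by ring.
  replace (Ci * 0)%C with (RtoC 0) by ring. rewrite Cexp_0. field.
Qed.

Lemma Csin_0 : Csin 0 = 0.
Proof.
  unfold Csin. replace (- (Ci * 0))%C with (RtoC 0) by ring.
  replace (Ci * 0)%C with (RtoC 0) by ring. rewrite Cexp_0. field.
  apply Ci_neq_0.
Qed.

Lemma Ccos_Ccos (z w : C) :
  (Ccos z * Ccos w = (Ccos (z - w) + Ccos (z + w)) / 2)%C.
Proof.
  unfold Ccos.
  replace (- (Ci * (z - w)))%C with (- (Ci * z) + Ci * w)%C by ring.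
  replace (- (Ci * (z + w)))%C with (- (Ci * z) + - (Ci * w))%C by ring.
  replace (Ci * (z - w))%C with (Ci * z + - (Ci * w))%C by ring.
  replace (Ci * (z + w))%C with (Ci * z + Ci * w)%C by ring.
  rewrite !Cexp_plus. field.
Qed.

Lemma Csin_Csin (z w : C) :
  (Csin z * Csin w = (Ccos (z - w) - Ccos (z + w)) / 2)%C.
Proof.
  unfold Ccos, Csin.
  replace (- (Ci * (z - w)))%C with (- (Ci * z) + Ci * w)%C by ring.
  replace (- (Ci * (z + w)))%C with (- (Ci * z) + - (Ci * w))%C by ring.
  replace (Ci * (z - w))%C with (Ci * z + - (Ci * w))%C by ring.
  replace (Ci * (z + w))%C with (Ci * z + Ci * w)%C by ring.
  rewrite !Cexp_plus.
  set (A := Cexp (Ci * z)). set (B := Cexp (- (Ci * z))).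
  set (D := Cexp (Ci * w)). set (F := Cexp (- (Ci * w))).
  transitivity ((A - B) * (D - F) / (2 * 2 * (Ci * Ci)))%C.
  { field. apply Ci_neq_0. }
  rewrite Ci2. field.
Qed.

Lemma Csin_plus (z w : C) :
  Csin (z + w) = (Csin z * Ccos w + Ccos z * Csin w)%C.
Proof.
  unfold Ccos, Csin.
  replace (- (Ci * (z + w)))%C with (- (Ci * z) + - (Ci * w))%C by ring.
  replace (Ci * (z + w))%C with (Ci * z + Ci * w)%C by ring.
  rewrite !Cexp_plus. field. apply Ci_neq_0.
Qed.

Lemma exp_le (x y : R) : x <= y -> exp x <= exp y.
Proof. intros [H| ->]; [left; now apply exp_increasing|right; reflexivity]. Qed.

Lemma Cmod_Cexp_le (z : C) :
  Cmod (Cexp (Ci * z)) <= exp (Rabs (Im z)) /\ Cmod (Cexp (- (Ci * z))) <= exp (Rabs (Im z)).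
Proof.
  rewrite !Cmod_Cexp; split; apply exp_le; simpl;
    generalize (Rle_abs (Im z)) (Rle_abs (- Im z)); rewrite Rabs_Ropp; unfold Im; lra.
Qed.

Lemma Cmod_RtoC_pos (x : R) : 0 <= x -> Cmod (RtoC x) = x.
Proof. intros; rewrite Cmod_R; now apply Rabs_pos_eq. Qed.

Lemma Cmod_Ccos_le (z : C) : Cmod (Ccos z) <= exp (Rabs (Im z)).
Proof.
  unfold Ccos. rewrite Cmod_div, (Cmod_RtoC_pos 2) by (apply two_neq_0 || lra).
  generalize (Cmod_triangle (Cexp (Ci * z)) (Cexp (- (Ci * z)))) (Cmod_Cexp_le z).
  lra.
Qed.

Lemma Cmod_Csin_le (z : C) : Cmod (Csin z) <= exp (Rabs (Im z)).
Proof.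
  unfold Csin. rewrite Cmod_div, Cmod_mult, Cmod_Ci, (Cmod_RtoC_pos 2);
    [|lra|apply Cmult_neq_0; [apply two_neq_0|apply Ci_neq_0]].
  unfold Cminus.
  generalize (Cmod_triangle (Cexp (Ci * z)) (- Cexp (- (Ci * z)))) (Cmod_Cexp_le z).
  rewrite Cmod_opp. lra.
Qed.

(** * From one-sided to two-sided derivatives *)

(** Continuing a function on the half-line by its tangent at 0 makes it
    two-sided differentiable there, so that the mean value theorem and the
    fundamental theorem of calculus apply on [0,L] without boundary cases. *)
Definition linear_extension (f : R -> C) (l : C) (t : R) : C :=
  if Rle_dec 0 t then f t else (f 0%R + RtoC t * l)%C.

Lemma linear_extension_eq (f : R -> C) (l : C) (t : R) :
  0 <= t -> linear_extension f l t = f t.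
Proof. intros H; unfold linear_extension; destruct Rle_dec; easy. Qed.

Lemma norm_Cmod (z : C) : @norm R_AbsRing C_R_NormedModule z = Cmod z.
Proof.
  transitivity (sqrt (Rabs (fst z) ^ 2 + Rabs (snd z) ^ 2)); [reflexivity|].
  now rewrite !pow2_abs.
Qed.

Lemma im_le_Cmod (z : C) : Rabs (Im z) <= Cmod z.
Proof. eapply Rle_trans; [apply Rmax_r|apply Rmax_Cmod]. Qed.

(** The filter definition of the one-sided derivative in epsilon-delta form,
    read off in each component. *)
Lemma half_line_estimate (f : R -> C) (x : R) (l : C) (eps : R) :
  0 <= x -> is_derive_half_line f x l -> 0 < eps ->
  exists delta : R, 0 < delta /\ forall h : R, Rabs h < delta -> 0 <= x + h ->
    Rabs (Re (f (x + h)%R - f x - RtoC h * l)%C) <= eps * Rabs h /\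
    Rabs (Im (f (x + h)%R - f x - RtoC h * l)%C) <= eps * Rabs h.
Proof.
  intros Hx [_ H] He.
  destruct (fun Q => H x Q (mkposreal _ He)) as [d Hd].
  { intros P HP. destruct HP as [d HP]. exists d. intros y Hy _. now apply HP. }
  exists d; split; [apply cond_pos|].
  intros h Hh Hp.
  assert (B : ball x d (x + h)).
  { unfold ball; simpl; unfold AbsRing_ball, abs, minus, plus, opp; simpl.
    now replace (x + h + - x) with h by ring. }
  specialize (Hd (x + h) B Hp). simpl in Hd.
  set (z := (f (x + h)%R - f x - RtoC h * l)%C).
  match type of Hd with norm ?w <= _ => assert (E : w = z) end.
  { unfold z. unfold minus, plus, opp, scal; simpl.
    unfold prod_plus, prod_opp, prod_scal, plus, opp, scal; simpl; unfold mult; simpl.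
    apply C_eq; unfold Re, Im; simpl; unfold plus, opp; simpl; ring. }
  rewrite E in Hd.
  match type of Hd with _ <= _ * ?n => assert (En : n = Rabs h) end.
  { unfold minus, plus, opp, norm; simpl. unfold abs; simpl. f_equal; ring. }
  rewrite En in Hd.
  rewrite norm_Cmod in Hd.
  split; (eapply Rle_trans; [|exact Hd]); [apply re_le_Cmod|apply im_le_Cmod].
Qed.

(** The continuation only matters at x = 0, where its slope l0 must be the
    one-sided derivative; at x > 0 a neighbourhood avoids the negative half-line. *)
Lemma cderiv_linear_extension (f : R -> C) (l l0 : C) (x : R) :
  0 <= x -> is_derive_half_line f x l -> (x = 0 -> l0 = l) ->
  cderiv (linear_extension f l0) x l.
Proof.
  intros Hx H H0.
  assert (K : forall eps : R, 0 < eps -> exists delta : posreal, forall h : R, h <> 0 ->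
    Rabs h < delta ->
    Rabs (Re (linear_extension f l0 (x + h)%R - linear_extension f l0 x - RtoC h * l)%C)
      <= eps * Rabs h /\
    Rabs (Im (linear_extension f l0 (x + h)%R - linear_extension f l0 x - RtoC h * l)%C)
      <= eps * Rabs h).
  { intros eps He. destruct (half_line_estimate f x l eps Hx H He) as [d [Hd HH]].
    assert (P : 0 < if Rlt_dec 0 x then Rmin d x else d).
    { destruct Rlt_dec; [apply Rmin_pos|]; easy. }
    exists (mkposreal _ P). simpl. intros h Hh Hb.
    rewrite (linear_extension_eq _ _ x Hx).
    destruct (Rle_dec 0 (x + h)) as [Hp|Hn].
    - rewrite linear_extension_eq by easy. apply HH; [|easy].
      apply Rlt_le_trans with (1 := Hb). destruct Rlt_dec; [apply Rmin_l|apply Rle_refl].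
    - destruct Rlt_dec as [Hx'|Hx'].
      + exfalso. apply Rlt_le_trans with (2 := Rmin_r _ _) in Hb.
        apply Rabs_def2 in Hb. lra.
      + assert (x = 0) by lra. subst x. rewrite H0 by easy.
        unfold linear_extension; destruct Rle_dec; [easy|].
        split; match goal with |- Rabs ?e <= _ => replace e with 0 by (simpl; ring) end;
          rewrite Rabs_R0;
        apply Rmult_le_pos; lra || apply Rabs_pos. }
  assert (D : forall h a b c : R, h <> 0 -> (a - b) / h - c = (a - b - h * c) / h).
  { intros; field; easy. }
  split; apply is_derive_Reals; intros eps He;
    destruct (K (eps / 2)) as [d Hd]; try lra; exists d; intros h Hh Hb;
    rewrite D by easy; unfold Rdiv; rewrite Rabs_mult, Rabs_inv;
    apply (Rmult_lt_reg_r (Rabs h)); try (now apply Rabs_pos_lt);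
    rewrite Rmult_assoc, Rinv_l, Rmult_1_r by (now apply Rabs_no_R0);
    apply Rle_lt_trans with (eps / 2 * Rabs h);
    try (apply Rmult_lt_compat_r; [now apply Rabs_pos_lt|lra]);
    destruct (Hd h Hh Hb) as [H1 H2].
  - eapply Rle_trans; [|exact H1]. right; f_equal. simpl. unfold Re; ring.
  - eapply Rle_trans; [|exact H2]. right; f_equal. simpl. unfold Im; ring.
Qed.

Definition solves (V : R -> R) (z : C) (v v1 : R -> C) (x0 x1 : R) : Prop :=
  forall x, x0 <= x <= x1 ->
    cderiv v x (v1 x) /\ cderiv v1 x ((RtoC (V x) - z) * v x)%C.

Lemma neumann_solution_extension (V : R -> R) (z : C) (u : R -> C) :
  neumann_solution V z u ->
  exists v v1 : R -> C,
    (forall x, 0 <= x -> v x = u x) /\ v 0 = RtoC 1 /\ v1 0 = RtoC 0 /\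
    forall L, solves V z v v1 0 L.
Proof.
  intros [u1 [u2 [H1 [H2 [H3 [H4 H5]]]]]].
  exists (linear_extension u (u1 0)), (linear_extension u1 (u2 0)).
  split; [|split; [|split]].
  - intros x Hx; now apply linear_extension_eq.
  - rewrite linear_extension_eq; [easy|lra].
  - rewrite linear_extension_eq; [easy|lra].
  - intros L x [Hx _]. rewrite !(linear_extension_eq _ _ x Hx). split.
    + apply cderiv_linear_extension; auto. now intros ->.
    + replace ((RtoC (V x) - z) * u x)%C with (u2 x).
      2:{ transitivity (RtoC (V x) * u x - z * u x)%C; [rewrite <- H3 by easy; ring|ring]. }
      apply cderiv_linear_extension; auto. now intros ->.
Qed.

(** * Gronwall estimates for the oscillator energy *)

Lemma nonincreasing_of_derivative (f f' : R -> R) (x0 x1 : R) :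
  x0 <= x1 -> (forall x, x0 <= x <= x1 -> is_derive f x (f' x)) ->
  (forall x, x0 <= x <= x1 -> f' x <= 0) -> f x1 <= f x0.
Proof.
  intros Hx Hd Hn.
  destruct (MVT_gen f x0 x1 f') as [c [Hc E]];
    rewrite ?Rmin_left, ?Rmax_right in * by easy.
  - intros x H; apply Hd; lra.
  - intros x H. apply continuity_pt_filterlim. apply @ex_derive_continuous.
    exists (f' x). now apply Hd.
  - generalize (Hn c Hc). nra.
Qed.

Lemma nondecreasing_of_derivative (f f' : R -> R) (x0 x1 : R) :
  x0 <= x1 -> (forall x, x0 <= x <= x1 -> is_derive f x (f' x)) ->
  (forall x, x0 <= x <= x1 -> 0 <= f' x) -> f x0 <= f x1.
Proof.
  intros Hx Hd Hn.
  apply Ropp_le_cancel.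
  apply (nonincreasing_of_derivative (fun t => - f t) (fun t => - f' t)); [easy| |].
  - intros x H. apply (is_derive_opp (V := R_NormedModule)). now apply Hd.
  - intros x H. generalize (Hn x H); lra.
Qed.

(** The function f exp(-(M - M(x0))) - P has derivative at most
    n (exp(-(M - M(x0))) - 1) <= 0.  The rates enter through primitives M and P,
    so that a bump of small mass costs little whatever its height. *)
Lemma gronwall (f f' M m P n : R -> R) (x0 x1 : R) :
  x0 <= x1 ->
  (forall x, x0 <= x <= x1 -> is_derive f x (f' x) /\ is_derive M x (m x) /\ is_derive P x (n x)) ->
  (forall x, x0 <= x <= x1 -> 0 <= m x /\ 0 <= n x /\ f' x <= m x * f x + n x) ->
  f x1 <= exp (M x1 - M x0) * (f x0 + (P x1 - P x0)).
Proof.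
  intros Hx Hd Hn.
  assert (HM : forall x, x0 <= x <= x1 -> M x0 <= M x).
  { intros x H. apply (nondecreasing_of_derivative M m); [easy| |];
      intros y Hy; [apply Hd|apply Hn]; lra. }
  assert (K : f x1 * exp (- (M x1 - M x0)) - P x1 <= f x0 * exp (- (M x0 - M x0)) - P x0).
  { apply (nonincreasing_of_derivative (fun x => f x * exp (- (M x - M x0)) - P x)
     (fun x => (f' x - m x * f x) * exp (- (M x - M x0)) - n x)); [easy| |].
    - intros x H. destruct (Hd x H) as [D1 [D2 D3]].
      apply (is_derive_ext (fun t => f t * exp (- (M t - M x0)) - P t)); [easy|].
      assert (E1 := is_derive_unique _ _ _ D1).
      assert (E2 := is_derive_unique _ _ _ D2).
      assert (E3 := is_derive_unique _ _ _ D3).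
      auto_derive.
      + repeat split; eexists; eassumption.
      + change (Derive (fun x => f x) x) with (Derive f x).
        change (Derive (fun x => M x) x) with (Derive M x).
        change (Derive (fun x => P x) x) with (Derive P x).
        rewrite E1, E2, E3. unfold Rminus. ring.
    - intros x H. destruct (Hn x H) as [N1 [N2 N3]].
      assert (X : exp (- (M x - M x0)) <= 1).
      { rewrite <- exp_0. apply exp_le. generalize (HM x H). lra. }
      assert (X0 := exp_pos (- (M x - M x0))).
      set (e := exp _) in *. nra. }
  rewrite Rminus_diag, Ropp_0, exp_0 in K.
  assert (X0 := exp_pos (M x1 - M x0)).
  replace (f x1) with (exp (M x1 - M x0) * (f x1 * exp (- (M x1 - M x0)))).
  - apply Rmult_le_compat_l; lra.
  - replace (exp (- (M x1 - M x0))) with (/ exp (M x1 - M x0)) by (now rewrite exp_Ropp).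
    field. lra.
Qed.

(** The real inner product of C = R^2, which appears when a squared modulus is
    differentiated. *)
Definition inner (z w : C) : R := Re z * Re w + Im z * Im w.

Lemma inner_le (z w : C) : Rabs (inner z w) <= Cmod z * Cmod w.
Proof.
  rewrite <- (Cmod_conj w), <- Cmod_mult.
  eapply Rle_trans; [|apply re_le_Cmod]. right; f_equal. unfold inner; simpl; unfold Re, Im; ring.
Qed.

Lemma is_derive_Cmod2 (f : R -> C) (x : R) (l : C) :
  cderiv f x l -> is_derive (fun t => Cmod (f t) ^ 2) x (2 * inner (f x) l).
Proof.
  intros [D1 D2].
  apply (is_derive_ext (fun t => Re (f t) ^ 2 + Im (f t) ^ 2)).
  { intros t; now rewrite Cmod2_alt. }
  evar_last.
  - apply (is_derive_plus (V := R_NormedModule)); apply is_derive_pow; eassumption.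
  - unfold plus, inner; simpl. ring.
Qed.

(** Conserved by the free equation - d'' = s^2 d. *)
Definition energy (s : R) (d d1 : R -> C) (x : R) : R :=
  s ^ 2 * Cmod (d x) ^ 2 + Cmod (d1 x) ^ 2.

Lemma energy_ge_0 (s : R) (d d1 : R -> C) (x : R) : 0 <= energy s d d1 x.
Proof. unfold energy; generalize (pow2_ge_0 (Cmod (d x))) (pow2_ge_0 (Cmod (d1 x))) (pow2_ge_0 s); nra. Qed.

(** Only the deviation of d'' from - s^2 d changes the energy. *)
Lemma is_derive_energy (s : R) (d d1 : R -> C) (x : R) (l2 : C) :
  cderiv d x (d1 x) -> cderiv d1 x l2 ->
  is_derive (energy s d d1) x (2 * inner (d1 x) (l2 + RtoC (s ^ 2) * d x)%C).
Proof.
  intros H1 H2.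
  evar_last.
  - unfold energy. apply (is_derive_plus (V := R_NormedModule)).
    + apply is_derive_scal. apply is_derive_Cmod2, H1.
    + apply is_derive_Cmod2, H2.
  - unfold plus, scal; simpl. unfold mult; simpl. unfold inner, Re, Im; simpl. ring.
Qed.

Lemma energy_cross_term (s a b : R) : 0 < s -> 2 * (a * b) <= (s ^ 2 * a ^ 2 + b ^ 2) / s.
Proof.
  intros Hs. apply (Rmult_le_reg_l s); [easy|]. field_simplify; [|lra].
  generalize (pow2_ge_0 (s * a - b)). nra.
Qed.

(** The defect of the oscillator equation is split into a part m |d|
    proportional to the solution, which produces exponential growth, and a
    forcing n H, which by 2 H |d'| <= H^2 + |d'|^2 enters through H^2 times the
    mass of n.  With d the difference of two solutions this is the basic
    comparison tool. *)
Lemma energy_growth (s H : R) (d d1 d2 : R -> C) (M m P n : R -> R) (x0 x1 : R) :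
  0 < s -> x0 <= x1 ->
  (forall x, x0 <= x <= x1 -> cderiv d x (d1 x) /\ cderiv d1 x (d2 x)) ->
  (forall x, x0 <= x <= x1 -> is_derive M x (m x) /\ is_derive P x (n x)) ->
  (forall x, x0 <= x <= x1 -> 0 <= m x /\ 0 <= n x /\
     Cmod (d2 x + RtoC (s ^ 2) * d x)%C <= m x * Cmod (d x) + n x * H) ->
  energy s d d1 x1 <=
    exp ((M x1 - M x0) / s + (P x1 - P x0)) * (energy s d d1 x0 + H ^ 2 * (P x1 - P x0)).
Proof.
  intros Hs Hx Hd HM Hb.
  replace ((M x1 - M x0) / s + (P x1 - P x0)) with ((M x1 / s + P x1) - (M x0 / s + P x0)) by (field; lra).
  replace (H ^ 2 * (P x1 - P x0)) with (H ^ 2 * P x1 - H ^ 2 * P x0) by ring.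
  apply (gronwall (energy s d d1) (fun x => 2 * inner (d1 x) (d2 x + RtoC (s ^ 2) * d x)%C)
     (fun x => M x / s + P x) (fun x => m x / s + n x)
     (fun x => H ^ 2 * P x) (fun x => H ^ 2 * n x)); [easy| |].
  - intros x Hxx. destruct (Hd x Hxx) as [D1 D2], (HM x Hxx) as [D3 D4].
    split; [|split].
    + now apply is_derive_energy.
    + apply (is_derive_plus (V := R_NormedModule)); [|easy].
      apply (is_derive_ext (fun t => / s * M t)). { intros t; exact (Rmult_comm _ _). }
      evar_last; [apply is_derive_scal, D3|]. unfold Rdiv; apply Rmult_comm.
    + apply is_derive_scal, D4.
  - intros x Hxx. destruct (Hb x Hxx) as [B1 [B2 B3]].
    split; [|split].
    + apply Rplus_le_le_0_compat; [|easy]. apply Rdiv_le_0_compat; easy.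
    + apply Rmult_le_pos; [apply pow2_ge_0|easy].
    + eapply Rle_trans; [apply Rmult_le_compat_l; [lra|]; eapply Rle_trans; [apply Rle_abs|apply inner_le]|].
      set (g := Cmod (d2 x + _)%C) in *. unfold energy.
      generalize (energy_cross_term s (Cmod (d x)) (Cmod (d1 x)) Hs).
      generalize (Cmod_ge_0 (d x)) (Cmod_ge_0 (d1 x)).
      set (a := Cmod (d x)) in *. set (b := Cmod (d1 x)) in *. intros Ha Hbb Hc.
      set (q := (s ^ 2 * a ^ 2 + b ^ 2) / s) in *.
      replace ((m x / s + n x) * (s ^ 2 * a ^ 2 + b ^ 2) + H ^ 2 * n x)
        with (m x * q + n x * (H ^ 2 + (s ^ 2 * a ^ 2 + b ^ 2))) by (unfold q; field; lra).
      assert (Y : 2 * (H * b) <= H ^ 2 + (s ^ 2 * a ^ 2 + b ^ 2)).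
      { generalize (pow2_ge_0 (H - b)) (pow2_ge_0 (s * a)). nra. }
      apply Rle_trans with (m x * (2 * (a * b)) + n x * (2 * (H * b))).
      * assert (b * g <= b * (m x * a + n x * H)) by (apply Rmult_le_compat_l; easy). nra.
      * apply Rplus_le_compat; apply Rmult_le_compat_l; easy.
Qed.

(** Run backwards in x, the growth bound shows that a solution cannot decay
    faster than exponentially; this is what makes relative errors meaningful. *)
Lemma energy_lower (s m : R) (d d1 d2 : R -> C) (x0 x1 : R) :
  0 < s -> 0 <= m -> x0 <= x1 ->
  (forall x, x0 <= x <= x1 -> cderiv d x (d1 x) /\ cderiv d1 x (d2 x)) ->
  (forall x, x0 <= x <= x1 -> Cmod (d2 x + RtoC (s ^ 2) * d x)%C <= m * Cmod (d x)) ->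
  exp (- (m / s * (x1 - x0))) * energy s d d1 x0 <= energy s d d1 x1.
Proof.
  intros Hs Hm Hx Hd Hb.
  assert (K : energy s d d1 x0 * exp (m / s * (x0 - x0)) <= energy s d d1 x1 * exp (m / s * (x1 - x0))).
  { apply (nondecreasing_of_derivative (fun x => energy s d d1 x * exp (m / s * (x - x0)))
      (fun x => (2 * inner (d1 x) (d2 x + RtoC (s ^ 2) * d x)%C + m / s * energy s d d1 x)
                 * exp (m / s * (x - x0)))); [easy| |].
    - intros x H. destruct (Hd x H) as [D1 D2].
      assert (D := is_derive_energy s d d1 x _ D1 D2).
      assert (E := is_derive_unique _ _ _ D).
      auto_derive; [exists (2 * inner (d1 x) (d2 x + RtoC (s ^ 2) * d x)%C); exact D|].
      change (Derive (fun x => energy s d d1 x) x) with (Derive (energy s d d1) x).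
      rewrite E. unfold Rminus, Rdiv. ring.
    - intros x H. apply Rmult_le_pos; [|left; apply exp_pos].
      assert (B := Hb x H).
      assert (I := inner_le (d1 x) (d2 x + RtoC (s ^ 2) * d x)%C).
      apply Rabs_le_between in I. destruct I as [I _].
      generalize (energy_cross_term s (Cmod (d x)) (Cmod (d1 x)) Hs).
      generalize (Cmod_ge_0 (d x)) (Cmod_ge_0 (d1 x)).
      unfold energy. set (g := Cmod (d2 x + _)%C) in *.
      set (a := Cmod (d x)) in *. set (b := Cmod (d1 x)) in *. intros Ha Hbb Hc.
      set (q := (s ^ 2 * a ^ 2 + b ^ 2) / s) in *.
      replace (m / s * (s ^ 2 * a ^ 2 + b ^ 2)) with (m * q) by (unfold q; field; lra).
      assert (b * g <= b * (m * a)) by (apply Rmult_le_compat_l; easy).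
      assert (m * (2 * (a * b)) <= m * q) by (apply Rmult_le_compat_l; easy). nra. }
  rewrite Rminus_diag, Rmult_0_r, exp_0, Rmult_1_r in K.
  assert (X0 := exp_pos (m / s * (x1 - x0))).
  rewrite exp_Ropp. apply (Rmult_le_reg_l (exp (m / s * (x1 - x0)))); [easy|].
  rewrite <- Rmult_assoc, Rinv_r; lra.
Qed.

(** * Comparison of solutions with each other and with free waves *)

Lemma is_derive_linear (m x : R) : is_derive (fun t : R => m * t) x m.
Proof. auto_derive; [easy|ring]. Qed.

(** A perturbation e of the energy parameter acts like a change of the
    potential. *)
Lemma solves_residual (V : R) (s : R) (e y : C) :
  ((RtoC V - (RtoC (s ^ 2) + e)) * y + RtoC (s ^ 2) * y)%C = ((RtoC V - e) * y)%C.
Proof. ring. Qed.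

Lemma Cmod_minus_le (z w : C) : Cmod (z - w) <= Cmod z + Cmod w.
Proof. unfold Cminus. rewrite <- (Cmod_opp w). apply Cmod_triangle. Qed.

Lemma potential_minus_le (V v : R) (e : C) (ep : R) :
  Rabs V <= v -> Cmod e <= ep -> Cmod (RtoC V - e) <= v + ep.
Proof.
  intros; eapply Rle_trans; [apply Cmod_minus_le|]. rewrite Cmod_R; lra.
Qed.

Lemma initial_energy (s : R) (u u1 : R -> C) :
  u 0 = RtoC 1 -> u1 0 = RtoC 0 -> energy s u u1 0 = s ^ 2.
Proof. intros H1 H2. unfold energy. rewrite H1, H2, Cmod_1, Cmod_0. ring. Qed.

Lemma solution_energy_upper (V : R -> R) (s v ep x : R) (e : C) (u u1 : R -> C) :
  0 < s -> 0 <= x -> Cmod e <= ep -> (forall t, 0 <= t <= x -> Rabs (V t) <= v) ->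
  solves V (RtoC (s ^ 2) + e) u u1 0 x -> u 0 = RtoC 1 -> u1 0 = RtoC 0 ->
  energy s u u1 x <= exp ((v + ep) / s * x) * s ^ 2.
Proof.
  intros Hs Hx He HV Hu H0 H1.
  assert (0 <= v + ep).
  { generalize (Rabs_pos (V 0)) (HV 0 ltac:(lra)) (Cmod_ge_0 e); lra. }
  eapply Rle_trans.
  - apply (energy_growth s 0 u u1 (fun t => (RtoC (V t) - (RtoC (s ^ 2) + e)) * u t)%C
      (fun t => (v + ep) * t) (fun _ => v + ep) (fun _ => 0) (fun _ => 0) 0 x); try easy.
    + intros t _; split; [apply is_derive_linear|apply @is_derive_const].
    + intros t Ht. rewrite solves_residual, Cmod_mult. repeat split; [easy|lra|].
      rewrite Rmult_0_l, Rplus_0_r. apply Rmult_le_compat_r; [apply Cmod_ge_0|].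
      apply potential_minus_le; auto.
  - rewrite (initial_energy s u u1) by easy. right.
    f_equal; [f_equal; field; lra|ring].
Qed.

Lemma solution_energy_lower (V : R -> R) (s v ep x : R) (e : C) (u u1 : R -> C) :
  0 < s -> 0 <= x -> Cmod e <= ep -> (forall t, 0 <= t <= x -> Rabs (V t) <= v) ->
  solves V (RtoC (s ^ 2) + e) u u1 0 x -> u 0 = RtoC 1 -> u1 0 = RtoC 0 ->
  exp (- ((v + ep) / s * x)) * s ^ 2 <= energy s u u1 x.
Proof.
  intros Hs Hx He HV Hu H0 H1.
  assert (0 <= v + ep).
  { generalize (Rabs_pos (V 0)) (HV 0 ltac:(lra)) (Cmod_ge_0 e); lra. }
  rewrite <- (initial_energy s u u1) by easy.
  replace ((v + ep) / s * x) with ((v + ep) / s * (x - 0)) by ring.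
  apply (energy_lower s (v + ep) u u1 (fun t => (RtoC (V t) - (RtoC (s ^ 2) + e)) * u t)%C); try easy.
  intros t Ht. rewrite solves_residual, Cmod_mult.
  apply Rmult_le_compat_r; [apply Cmod_ge_0|]. apply potential_minus_le; auto.
Qed.

Lemma solution_size (V : R -> R) (s v ep x : R) (e : C) (u u1 : R -> C) :
  0 < s -> 0 <= x -> Cmod e <= ep -> (forall t, 0 <= t <= x -> Rabs (V t) <= v) ->
  solves V (RtoC (s ^ 2) + e) u u1 0 x -> u 0 = RtoC 1 -> u1 0 = RtoC 0 ->
  Cmod (u x) ^ 2 <= exp ((v + ep) / s * x).
Proof.
  intros Hs Hx He HV Hu H0 H1.
  assert (K := solution_energy_upper V s v ep x e u u1 Hs Hx He HV Hu H0 H1).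
  unfold energy in K. generalize (pow2_ge_0 (Cmod (u1 x))). intros.
  apply (Rmult_le_reg_l (s ^ 2)); [now apply pow_lt|]. lra.
Qed.

Lemma cderiv_RtoC (f : R -> R) (x l : R) :
  is_derive f x l -> cderiv (fun t => RtoC (f t)) x (RtoC l).
Proof. intros H; split; [exact H|exact (is_derive_const 0 x)]. Qed.

(** The imaginary part solves the same real equation with zero data, so its
    energy stays 0. *)
Lemma real_solution (V : R -> R) (s v x : R) (u u1 : R -> C) :
  0 < s -> 0 <= x -> (forall t, 0 <= t <= x -> Rabs (V t) <= v) ->
  solves V (RtoC (s ^ 2)) u u1 0 x -> u 0 = RtoC 1 -> u1 0 = RtoC 0 ->
  u x = RtoC (Re (u x)) /\ u1 x = RtoC (Re (u1 x)).
Proof.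
  intros Hs Hx HV Hu H0 H1.
  assert (0 <= v). { generalize (Rabs_pos (V 0)) (HV 0 ltac:(lra)); lra. }
  assert (K : energy s (fun t => RtoC (Im (u t))) (fun t => RtoC (Im (u1 t))) x <=
     exp ((v * x - v * 0) / s + (0 - 0)) *
      (energy s (fun t => RtoC (Im (u t))) (fun t => RtoC (Im (u1 t))) 0 + 0 ^ 2 * (0 - 0))).
  { apply (energy_growth s 0 _ _ (fun t => RtoC ((V t - s ^ 2) * Im (u t)))
      (fun t => v * t) (fun _ => v) (fun _ => 0) (fun _ => 0) 0 x); try easy.
    - intros t Ht. destruct (Hu t Ht) as [[_ D1] [_ D2]].
      split; apply cderiv_RtoC; [exact D1|].
      evar_last; [exact D2|]. unfold Im, Re; cbn -[pow]. ring.
    - intros t _; split; [apply is_derive_linear|apply @is_derive_const].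
    - intros t Ht. repeat split; [easy|lra|].
      rewrite <- RtoC_mult, <- RtoC_plus, !Cmod_R.
      replace ((V t - s ^ 2) * Im (u t) + s ^ 2 * Im (u t)) with (V t * Im (u t)) by ring.
      rewrite Rabs_mult. generalize (HV t Ht) (Rabs_pos (Im (u t))). nra. }
  unfold energy in K. rewrite H0, H1, !Cmod_R in K. simpl Im in K.
  rewrite !Rabs_R0, !pow2_abs in K.
  assert (Z : s ^ 2 * Im (u x) ^ 2 + Im (u1 x) ^ 2 <= 0) by (eapply Rle_trans; [exact K|right; ring]).
  assert (S2 := pow_lt s 2 Hs).
  assert (Z1 : Im (u1 x) ^ 2 = 0) by (generalize (pow2_ge_0 (Im (u x))) (pow2_ge_0 (Im (u1 x))); nra).
  assert (Z2 : Im (u x) ^ 2 = 0) by (generalize (pow2_ge_0 (Im (u x))) (pow2_ge_0 (Im (u1 x))); nra).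
  split; apply C_eq; try reflexivity; simpl; nra.
Qed.

(** The difference satisfies the perturbed equation with the forcing
    - e v0, whose mass on [0,x] is of order ep x. *)
Lemma solution_difference (V : R -> R) (s v ep B x : R) (e : C) (u u1 v0 v1 : R -> C) :
  0 < s -> 0 <= x -> Cmod e <= ep -> (forall t, 0 <= t <= x -> Rabs (V t) <= v) ->
  solves V (RtoC (s ^ 2) + e) u u1 0 x -> u 0 = RtoC 1 -> u1 0 = RtoC 0 ->
  solves V (RtoC (s ^ 2)) v0 v1 0 x -> v0 0 = RtoC 1 -> v1 0 = RtoC 0 ->
  (forall t, 0 <= t <= x -> Cmod (v0 t) <= B) ->
  energy s (fun t => u t - v0 t)%C (fun t => u1 t - v1 t)%C x
    <= exp ((v + ep) / s * x + ep * x) * (B ^ 2 * (ep * x)).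
Proof.
  intros Hs Hx He HV Hu H0 H1 Hv Hv0 Hv1 HB.
  assert (0 <= ep) by (generalize (Cmod_ge_0 e); lra).
  assert (0 <= v). { generalize (Rabs_pos (V 0)) (HV 0 ltac:(lra)); lra. }
  eapply Rle_trans.
  - apply (energy_growth s B _ _
      (fun t => (RtoC (V t) - (RtoC (s ^ 2) + e)) * u t - (RtoC (V t) - RtoC (s ^ 2)) * v0 t)%C
      (fun t => (v + ep) * t) (fun _ => v + ep) (fun t => ep * t) (fun _ => ep) 0 x); try easy.
    + intros t Ht. destruct (Hu t Ht), (Hv t Ht). split; now apply cderiv_minus.
    + intros t _; split; apply is_derive_linear.
    + intros t Ht. repeat split; [lra|lra|].
      replace ((RtoC (V t) - (RtoC (s ^ 2) + e)) * u t - (RtoC (V t) - RtoC (s ^ 2)) * v0 t +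
         RtoC (s ^ 2) * (u t - v0 t))%C with ((RtoC (V t) - e) * (u t - v0 t) - e * v0 t)%C by ring.
      eapply Rle_trans; [apply Cmod_minus_le|]. rewrite !Cmod_mult.
      apply Rplus_le_compat; apply Rmult_le_compat; try apply Cmod_ge_0; auto; try lra.
      apply potential_minus_le; auto.
  - right. f_equal; [f_equal; field; lra|].
    unfold energy. rewrite H0, H1, Hv0, Hv1.
    replace (1 - 1)%C with (RtoC 0) by ring. replace (0 - 0)%C with (RtoC 0) by ring.
    rewrite Cmod_0. ring.
Qed.

(** Free wave of frequency kap with value al and derivative kap be at T. *)
Definition wave (al be kap : C) (T x : R) : C :=
  (al * Ccos (kap * RtoC (x - T)) + be * Csin (kap * RtoC (x - T)))%C.

Lemma cderiv_wave (al be kap : C) (T x : R) :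
  cderiv (wave al be kap T) x (wave (kap * be) (- (kap * al)) kap T x).
Proof.
  unfold wave.
  apply (cderiv_shift (fun y => al * Ccos (kap * RtoC y) + be * Csin (kap * RtoC y))%C T x).
  eapply cderiv_val; [|apply cderiv_plus; apply cderiv_scal; [apply cderiv_Ccos|apply cderiv_Csin]].
  ring.
Qed.

Lemma wave_start (al be kap : C) (T : R) : wave al be kap T T = al.
Proof.
  unfold wave. rewrite Rminus_diag. replace (kap * 0)%C with (RtoC 0) by ring.
  rewrite Ccos_0, Csin_0. ring.
Qed.

Lemma wave_size (al be r A2 : R) (kap : C) (T x : R) :
  al ^ 2 + be ^ 2 <= A2 -> Rabs (Im (kap * RtoC (x - T))%C) <= r ->
  Cmod (wave al be kap T x) <= exp r * sqrt (2 * A2).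
Proof.
  intros HA Hr. unfold wave.
  eapply Rle_trans; [apply Cmod_triangle|]. rewrite !Cmod_mult, !Cmod_R.
  assert (C1 := Cmod_Ccos_le (kap * RtoC (x - T))).
  assert (C2 := Cmod_Csin_le (kap * RtoC (x - T))).
  apply exp_le in Hr.
  apply Rle_trans with (exp r * (Rabs al + Rabs be)).
  - generalize (Rabs_pos al) (Rabs_pos be). nra.
  - apply Rmult_le_compat_l; [left; apply exp_pos|].
    apply Rsqr_incr_0_var; [|apply sqrt_pos].
    rewrite Rsqr_sqrt by nra. unfold Rsqr.
    rewrite <- (pow2_abs al), <- (pow2_abs be) in HA. generalize (pow2_ge_0 (Rabs al - Rabs be)). nra.
Qed.

(** The difference of u and the wave sees the potential minus e as
    a coefficient and is forced by the wave times the potential plus the error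
    kap^2 - s^2 - e of the frequency.  The forcing has small mass when the
    potential and that error do, although the coefficient e itself has mass of
    order 1 on an interval of length 1/|e|. *)
Lemma wave_comparison (V Q q : R -> R) (s ep ep' H T x : R) (e al be kap : C) (u u1 : R -> C) :
  0 < s -> T <= x -> Cmod e <= ep -> 0 <= ep' ->
  Cmod (kap * kap - RtoC (s ^ 2) - e)%C <= ep' ->
  (forall t, T <= t <= x -> Rabs (V t) <= q t /\ is_derive Q t (q t)) ->
  solves V (RtoC (s ^ 2) + e) u u1 T x ->
  (forall t, T <= t <= x -> Cmod (wave al be kap T t) <= H) ->
  let d := (fun t => u t - wave al be kap T t)%C in
  let d1 := (fun t => u1 t - wave (kap * be) (- (kap * al)) kap T t)%C in
  energy s d d1 x
    <= exp ((Q x - Q T + ep * (x - T)) / s + (Q x - Q T + ep' * (x - T)))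
       * (energy s d d1 T + H ^ 2 * (Q x - Q T + ep' * (x - T))).
Proof.
  intros Hs Hx He Hep' Hk Hq Hu HH d d1.
  assert (0 <= ep) by (generalize (Cmod_ge_0 e); lra).
  replace (Q x - Q T + ep * (x - T)) with ((Q x + ep * x) - (Q T + ep * T)) by ring.
  replace (Q x - Q T + ep' * (x - T)) with ((Q x + ep' * x) - (Q T + ep' * T)) by ring.
  apply (energy_growth s H d d1
      (fun t => (RtoC (V t) - (RtoC (s ^ 2) + e)) * u t - - (kap * kap) * wave al be kap T t)%C
      (fun t => Q t + ep * t) (fun t => q t + ep) (fun t => Q t + ep' * t) (fun t => q t + ep') T x); try easy.
  - intros t Ht. destruct (Hu t Ht). split; apply cderiv_minus; try easy.
    + apply cderiv_wave.
    + eapply cderiv_val; [|apply cderiv_wave]. unfold wave; ring.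
  - intros t Ht. destruct (Hq t Ht) as [_ D].
    split; apply (is_derive_plus (V := R_NormedModule)); try easy; apply is_derive_linear.
  - intros t Ht. destruct (Hq t Ht) as [B _].
    assert (0 <= q t) by (generalize (Rabs_pos (V t)); lra).
    repeat split; [lra|lra|].
    unfold d. set (w := wave al be kap T t).
    replace ((RtoC (V t) - (RtoC (s ^ 2) + e)) * u t - - (kap * kap) * w + RtoC (s ^ 2) * (u t - w))%C
      with ((RtoC (V t) - e) * (u t - w) + (RtoC (V t) + (kap * kap - RtoC (s ^ 2) - e)) * w)%C by ring.
    eapply Rle_trans; [apply Cmod_triangle|]. rewrite !Cmod_mult.
    apply Rplus_le_compat; apply Rmult_le_compat; try apply Cmod_ge_0.
    + apply potential_minus_le; auto.
    + apply Rle_refl.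
    + eapply Rle_trans; [apply Cmod_triangle|]. rewrite Cmod_R. lra.
    + now apply HH.
Qed.

(** * Relative error of the free-wave approximation across one bump *)

Definition neumann (V : R -> R) (z : C) (L : R) (u u1 : R -> C) : Prop :=
  solves V z u u1 0 L /\ u 0 = RtoC 1 /\ u1 0 = RtoC 0.

(** The situation on the scale L: an arbitrary potential bounded by v up to T,
    and a potential dominated by a density q of total mass at most J from T
    to L. *)
Definition bump_regime (V : R -> R) (v J T L : R) : Prop :=
  0 <= T <= L /\ 1 <= L /\ (forall t, 0 <= t <= T -> Rabs (V t) <= v) /\
  exists Q q : R -> R, forall t, T <= t <= L ->
    Rabs (V t) <= q t /\ is_derive Q t (q t) /\ Q t - Q T <= J.

(** Exponential bound for the squared modulus on [0,T] of solutions whose parameter s is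
    at least s0 and whose energy is shifted by at most r. *)
Definition gain (s0 r v T : R) : R := exp ((v + r) / s0 * T).

(** One power of the gain each for the growth of a difference of solutions, for
    its forcing, and for the division by the squared amplitude; the factor
    1 + T makes both T/L and 1/L small. *)
Definition smallness (s0 r v T L : R) : R := gain s0 r v T ^ 3 * (1 + T) / L.

(** First-order expansion of the square root of s^2 + a/L. *)
Definition frequency (s L : R) (a : C) : C := (RtoC s + a / RtoC (2 * s * L))%C.

Lemma gain_ge_1 (s0 r v T : R) : 0 < s0 -> 0 <= r -> 0 <= v -> 0 <= T -> 1 <= gain s0 r v T.
Proof.
  intros. unfold gain. rewrite <- exp_0. apply exp_le.
  apply Rmult_le_pos; [apply Rdiv_le_0_compat|]; lra.
Qed.

Lemma gain_bound (s0 s r ep v T : R) :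
  0 < s0 <= s -> 0 <= ep <= r -> 0 <= v -> 0 <= T ->
  exp ((v + ep) / s * T) <= gain s0 r v T.
Proof.
  intros. apply exp_le. apply Rmult_le_compat_r; [easy|].
  unfold Rdiv. apply Rmult_le_compat; [lra| |lra|].
  - left; apply Rinv_0_lt_compat; lra.
  - apply Rinv_le_contravar; lra.
Qed.

Lemma neumann_restrict (V : R -> R) (z : C) (L x : R) (u u1 : R -> C) :
  x <= L -> neumann V z L u u1 -> solves V z u u1 0 x.
Proof. intros Hx [H _] t Ht. apply H; lra. Qed.

Lemma size_le_gain (V : R -> R) (s0 s r v J T L t : R) (e : C) (u u1 : R -> C) :
  0 < s0 <= s -> 0 <= r -> 0 <= v -> bump_regime V v J T L -> Cmod e <= r / L ->
  neumann V (RtoC (s ^ 2) + e) L u u1 -> 0 <= t <= T ->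
  Cmod (u t) ^ 2 <= gain s0 r v T.
Proof.
  intros Hs Hr Hv [HT [HL [HV _]]] He Hu Ht.
  eapply Rle_trans; [apply (solution_size V s v (r / L) t e u u1); try easy; try lra|].
  - intros; apply HV; lra.
  - apply neumann_restrict with (2 := Hu); lra.
  - apply Hu.
  - apply Hu.
  - assert (0 <= r / L <= r).
    { split; [apply Rdiv_le_0_compat; lra|].
      apply (Rmult_le_reg_r L); [lra|]. unfold Rdiv; rewrite Rmult_assoc, Rinv_l by lra. nra. }
    eapply Rle_trans; [|apply gain_bound with (s := s) (ep := r / L); try easy; lra].
    apply exp_le. apply Rmult_le_compat_l; [|lra]. apply Rdiv_le_0_compat; lra.
Qed.

(** The second factor is the squared amplitude of the free wave that continues
    u beyond T; that wave has real coefficients, so this sum of squares is the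
    energy of u at T divided by s^2. *)
Lemma amplitude_lower (V : R -> R) (s0 s r v J T L : R) (u u1 : R -> C) :
  0 < s0 <= s -> 0 <= r -> 0 <= v -> bump_regime V v J T L ->
  neumann V (RtoC (s ^ 2)) L u u1 ->
  1 <= gain s0 r v T * (Re (u T) ^ 2 + (Re (u1 T) / s) ^ 2).
Proof.
  intros Hs Hr Hv [HT [HL [HV _]]] Hu.
  assert (Hu' : solves V (RtoC (s ^ 2) + 0) u u1 0 T).
  { rewrite Cplus_0_r. apply neumann_restrict with (2 := Hu); lra. }
  destruct (real_solution V s v T u u1) as [E1 E2]; try apply Hu; try lra; auto.
  { apply neumann_restrict with (2 := Hu); lra. }
  assert (K := solution_energy_lower V s v 0 T 0 u u1 ltac:(lra) ltac:(lra)
    ltac:(rewrite Cmod_0; lra) HV Hu' (proj1 (proj2 Hu)) (proj2 (proj2 Hu))).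
  unfold energy in K. rewrite E1, E2, !Cmod_R, !pow2_abs in K.
  assert (G := gain_bound s0 s r 0 v T Hs ltac:(lra) Hv ltac:(lra)).
  set (g := gain s0 r v T) in *. set (A := Re (u T)) in *. set (B := Re (u1 T)) in *.
  rewrite exp_Ropp in K.
  assert (X := exp_pos ((v + 0) / s * T)). set (y := exp _) in *.
  assert (S2 : 0 < s ^ 2) by (apply pow_lt; lra).
  apply (Rmult_le_reg_l (s ^ 2)); [easy|].
  apply Rle_trans with (y * (/ y * s ^ 2)).
  { right; field; lra. }
  apply Rle_trans with (g * (/ y * s ^ 2)).
  { apply Rmult_le_compat_r; [|easy]. apply Rmult_le_pos; [left; now apply Rinv_0_lt_compat|lra]. }
  apply Rle_trans with (g * (s ^ 2 * A ^ 2 + B ^ 2)).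
  - apply Rmult_le_compat_l; lra.
  - right; field; lra.
Qed.

Lemma Im_div_R (a : C) (r : R) : r <> 0 -> Im (a / RtoC r) = Im a / r.
Proof. intros; unfold Im; simpl. field; easy. Qed.

Lemma Re_div_R (a : C) (r : R) : r <> 0 -> Re (a / RtoC r) = Re a / r.
Proof. intros; unfold Re; simpl. field; easy. Qed.

(** The error is of order L^(-2), so its integral over [0,L] vanishes in the
    limit. *)
Lemma frequency_square (s L : R) (a : C) : s <> 0 -> L <> 0 ->
  (frequency s L a * frequency s L a - RtoC (s ^ 2) - a / RtoC L
    = a * a / RtoC (4 * s ^ 2 * L ^ 2))%C.
Proof.
  intros Hs HL. unfold frequency.
  replace (RtoC (2 * s * L)) with (RtoC 2 * RtoC s * RtoC L)%C by (now rewrite !RtoC_mult).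
  replace (RtoC (4 * s ^ 2 * L ^ 2)) with (RtoC 4 * RtoC s * RtoC s * RtoC L * RtoC L)%C
    by (rewrite <- !RtoC_mult; f_equal; ring).
  replace (RtoC (s ^ 2)) with (RtoC s * RtoC s)%C by (rewrite <- RtoC_mult; f_equal; ring).
  replace (RtoC 4) with (RtoC 2 * RtoC 2)%C by (rewrite <- RtoC_mult; f_equal; ring).
  assert (RtoC s <> 0) by (intros E; apply RtoC_inj in E; easy).
  assert (RtoC L <> 0) by (intros E; apply RtoC_inj in E; easy).
  field. split; easy.
Qed.

(** Frequencies of order 1/L off the real axis keep the waves bounded on
    [0,L]. *)
Lemma frequency_phase (s0 s r L y : R) (a : C) :
  0 < s0 <= s -> 1 <= L -> Cmod a <= r -> 0 <= y <= L ->
  Rabs (Im (frequency s L a * RtoC y)%C) <= r / (2 * s0).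
Proof.
  intros Hs HL Ha Hy.
  assert (0 < s * L) by (apply Rmult_lt_0_compat; lra).
  replace (Im (frequency s L a * RtoC y)%C) with (Im a * (y / L / (2 * s))).
  2:{ transitivity (Im (a / RtoC (2 * s * L))%C * y).
      - rewrite Im_div_R by lra. field; lra.
      - unfold frequency, Im; simpl; ring. }
  rewrite Rabs_mult. unfold Rdiv at 3.
  assert (Y : 0 <= y / L <= 1).
  { split; [apply Rdiv_le_0_compat; lra|]. apply (Rmult_le_reg_r L); [lra|].
    unfold Rdiv; rewrite Rmult_assoc, Rinv_l by lra. lra. }
  assert (I1 : 0 < / (2 * s) <= / (2 * s0)).
  { split; [apply Rinv_0_lt_compat; lra|apply Rinv_le_contravar; lra]. }
  apply Rmult_le_compat; try apply Rabs_pos.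
  - eapply Rle_trans; [apply im_le_Cmod|easy].
  - rewrite Rabs_pos_eq; unfold Rdiv at 1; nra.
Qed.

(** Squared error of the free wave relative to its squared amplitude.  The
    error at T comes from [solution_difference] and from the change of the
    frequency by a/(2sL); [wave_comparison] propagates it to L, adding the
    mass of the bump and of the frequency error. *)
Lemma approximation (s0 r v I : R) :
  0 < s0 -> 0 <= r -> 0 <= v -> 0 <= I ->
  exists K, 0 <= K /\ forall (V : R -> R) (lam T L s : R) (a : C) (u u1 u0 u01 : R -> C),
    bump_regime V v (I * lam) T L -> 0 <= lam <= 1 -> s0 <= s -> Cmod a <= r ->
    neumann V (RtoC (s ^ 2)) L u0 u01 -> neumann V (RtoC (s ^ 2) + a / RtoC L) L u u1 ->
    forall x, T <= x <= L ->
      Cmod (u x - wave (Re (u0 T)) (Re (u01 T) / s)%R (frequency s L a) T x)%C ^ 2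
        <= K * (smallness s0 r v T L + lam) * (Re (u0 T) ^ 2 + (Re (u01 T) / s) ^ 2).
Proof.
  intros Hs0 Hr Hv HI.
  (* ep2 / L^2 bounds the error a^2/(4 s^2 L^2) of the squared frequency *)
  set (ep2 := r ^ 2 / (4 * s0 ^ 2)).
  set (E4 := exp ((I + r) / s0 + (I + ep2))).
  set (K1 := 2 * exp r * r + 2 * ep2).
  set (K2 := 2 * exp (r / (2 * s0)) ^ 2 * (I + ep2)).
  assert (0 <= ep2). { apply Rdiv_le_0_compat; [apply pow2_ge_0|]. generalize (pow_lt s0 2 Hs0); lra. }
  assert (0 < E4) by apply exp_pos.
  assert (0 < exp r) by apply exp_pos.
  assert (0 <= K1) by (unfold K1; nra).
  assert (0 <= K2). { unfold K2. apply Rmult_le_pos; [|lra]. generalize (pow2_ge_0 (exp (r / (2 * s0)))); lra. }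
  exists (E4 * (K1 + K2) / s0 ^ 2). split.
  { apply Rdiv_le_0_compat; [|now apply pow_lt]. apply Rmult_le_pos; lra. }
  intros V lam T L s a u u1 u0 u01 HB Hlam Hs Ha Hu0 Hu x Hx.
  assert (G1 := amplitude_lower V s0 s r v (I * lam) T L u0 u01 (conj Hs0 Hs) Hr Hv HB Hu0).
  assert (S0 := fun t => size_le_gain V s0 s r v (I * lam) T L t 0 u0 u01 (conj Hs0 Hs) Hr Hv HB).
  assert (HB' := HB).
  destruct HB' as [HT [HL [HV [Q [q HQ]]]]].
  set (al := Re (u0 T)) in *. set (be := Re (u01 T) / s) in *.
  set (A2 := al ^ 2 + be ^ 2) in *.
  assert (HA2 : 0 <= A2) by (unfold A2; generalize (pow2_ge_0 al) (pow2_ge_0 be); lra).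
  set (X := gain s0 r v T) in *.
  assert (X1 : 1 <= X) by (apply gain_ge_1; lra).
  set (th := smallness s0 r v T L).
  assert (Hth : X ^ 3 * (1 + T) / L = th) by reflexivity.
  assert (iL : 0 < / L) by (apply Rinv_0_lt_compat; lra).
  assert (iL1 : / L <= 1) by (rewrite <- Rinv_1; apply Rinv_le_contravar; lra).
  assert (X3 : 1 <= X ^ 3) by (apply pow_R1_Rle; lra).
  assert (Lth : / L <= th).
  { rewrite <- Hth. unfold Rdiv. rewrite <- (Rmult_1_l (/ L)) at 1.
    apply Rmult_le_compat_r; nra. }
  assert (XTth : X ^ 2 * T * / L <= th * A2).
  { rewrite <- Hth. unfold Rdiv.
    replace (X ^ 3 * (1 + T) * / L * A2) with (X ^ 2 * (1 + T) * / L * (X * A2)) by ring.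
    assert (0 <= X ^ 2 * / L) by (apply Rmult_le_pos; [apply pow2_ge_0|lra]). nra. }
  set (e := (a / RtoC L)%C) in *.
  assert (He : Cmod e <= r / L).
  { unfold e. rewrite Cmod_div, Cmod_RtoC_pos; [|lra|intros E; apply RtoC_inj in E; lra].
    apply Rmult_le_compat_r; lra. }
  assert (Hep : 0 <= r / L <= r) by (unfold Rdiv; nra).
  destruct (real_solution V s v T u0 u01) as [R1 R2]; try apply Hu0; try lra; auto.
  { apply neumann_restrict with (2 := Hu0); lra. }
  set (kap := frequency s L a).
  (* error at T caused by the shift a/L of the energy on [0,T] *)
  assert (D3 : energy s (fun t => u t - u0 t)%C (fun t => u1 t - u01 t)%C T
     <= exp r * r * (th * A2)).
  { eapply Rle_trans.
    - apply (solution_difference V s v (r / L) (sqrt X) T e u u1 u0 u01); try apply Hu; try apply Hu0; try lra; auto.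
      + apply neumann_restrict with (2 := Hu); lra.
      + apply neumann_restrict with (2 := Hu0); lra.
      + intros t Ht. apply Rsqr_incr_0_var; [|apply sqrt_pos].
        rewrite Rsqr_sqrt by lra. rewrite Rsqr_pow2. apply S0; [|now rewrite Cplus_0_r|lra].
        rewrite Cmod_0; lra.
    - rewrite pow2_sqrt by lra. rewrite exp_plus.
      apply Rle_trans with (X * exp r * (X * (r / L * T))).
      + apply Rmult_le_compat_r; [apply Rmult_le_pos; [lra|]; apply Rmult_le_pos; lra|].
        apply Rmult_le_compat; try (left; apply exp_pos).
        * apply gain_bound; lra.
        * apply exp_le. unfold Rdiv. rewrite Rmult_assoc. rewrite <- (Rmult_1_r r) at 2.
          apply Rmult_le_compat_l; [easy|]. apply (Rmult_le_reg_l L); [lra|].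
          rewrite <- Rmult_assoc, Rinv_r; lra.
      + replace (X * exp r * (X * (r / L * T))) with (exp r * r * (X ^ 2 * T * / L)) by (unfold Rdiv; ring).
        apply Rmult_le_compat_l; [nra|easy]. }
  set (d := (fun t => u t - wave al be kap T t)%C).
  set (d1 := (fun t => u1 t - wave (kap * be) (- (kap * al)) kap T t)%C).
  (* the wave has the slope kap be instead of s be = Re (u01 T) at T *)
  assert (D4 : energy s d d1 T <= K1 * (th * A2)).
  { assert (Z1 : d T = (u T - u0 T)%C).
    { unfold d. rewrite wave_start, R1. reflexivity. }
    assert (Z2 : d1 T = (u1 T - u01 T - a / RtoC (2 * s * L) * RtoC be)%C).
    { unfold d1. rewrite wave_start, R2.
      replace (Re (u01 T)) with (s * be) by (unfold be; field; lra).
      unfold kap, frequency. rewrite (RtoC_mult s be). ring. }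
    unfold energy in *. rewrite Z1, Z2.
    set (m := (a / RtoC (2 * s * L) * RtoC be)%C).
    assert (M1 : Cmod m ^ 2 <= ep2 * (th * A2)).
    { unfold m. rewrite Cmod_mult, Cmod_R, Rpow_mult_distr, pow2_abs.
      rewrite Cmod_div; [|intros E; apply RtoC_inj in E; nra].
      rewrite Cmod_RtoC_pos by nra.
      assert (B : Cmod a / (2 * s * L) <= r / (2 * s0) * / L).
      { replace (Cmod a / (2 * s * L)) with (Cmod a * / (2 * s) * / L) by (field; lra).
        apply Rmult_le_compat_r; [lra|]. unfold Rdiv. apply Rmult_le_compat; try apply Cmod_ge_0; auto.
        - left; apply Rinv_0_lt_compat; lra.
        - apply Rinv_le_contravar; lra. }
      assert (B0 : 0 <= Cmod a / (2 * s * L)).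
      { apply Rdiv_le_0_compat; [apply Cmod_ge_0|nra]. }
      assert (B2 : (Cmod a / (2 * s * L)) ^ 2 <= ep2 * / L).
      { apply Rle_trans with ((r / (2 * s0) * / L) ^ 2); [now apply pow_incr|].
        replace ((r / (2 * s0) * / L) ^ 2) with (ep2 * (/ L * / L)) by (unfold ep2; field; lra).
        apply Rmult_le_compat_l; [easy|]. nra. }
      rewrite <- Rmult_assoc. apply Rmult_le_compat; try apply pow2_ge_0.
      - eapply Rle_trans; [exact B2|]. apply Rmult_le_compat_l; lra.
      - unfold A2. generalize (pow2_ge_0 al); lra. }
    assert (T1 := Cmod_minus_le (u1 T - u01 T) m).
    assert (P1 := Cmod_ge_0 (u1 T - u01 T)). assert (P2 := Cmod_ge_0 m).
    assert (P3 := Cmod_ge_0 (u1 T - u01 T - m)).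
    set (p := Cmod (u1 T - u01 T)) in *. set (p' := Cmod m) in *. set (p'' := Cmod (_ - m)) in *.
    assert (p'' ^ 2 <= 2 * p ^ 2 + 2 * p' ^ 2).
    { apply Rle_trans with ((p + p') ^ 2); [now apply pow_incr|]. generalize (pow2_ge_0 (p - p')); nra. }
    assert (0 <= s ^ 2 * Cmod (u T - u0 T) ^ 2) by (apply Rmult_le_pos; apply pow2_ge_0).
    unfold K1. nra. }
  assert (Ap : A2 = al ^ 2 + be ^ 2) by reflexivity.
  assert (WS : forall t, T <= t <= L -> Cmod (wave al be kap T t) <= exp (r / (2 * s0)) * sqrt (2 * A2)).
  { intros t Ht. apply wave_size; [lra|]. apply frequency_phase; lra. }
  assert (D5 : energy s d d1 x <= E4 * (K1 * (th * A2) + K2 * (th + lam) * A2)).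
  { assert (HQx := proj2 (proj2 (HQ x Hx))).
    assert (Ik : 0 <= Q x - Q T).
    { assert (Q T <= Q x); [|lra].
      apply (nondecreasing_of_derivative Q q); [lra| |]; intros t Ht;
        destruct (HQ t ltac:(lra)) as [B1 [B2 _]]; [easy|]. generalize (Rabs_pos (V t)); lra. }
    assert (Hil : I * lam <= I) by nra.
    assert (iLL : 0 <= ep2 * / L * / L) by (apply Rmult_le_pos; [apply Rmult_le_pos|]; lra).
    assert (iLx : / L * (x - T) <= 1).
    { apply (Rmult_le_reg_l L); [lra|]. rewrite <- Rmult_assoc, Rinv_r; lra. }
    assert (eLx : ep2 * / L * / L * (x - T) <= ep2 * / L).
    { rewrite Rmult_assoc. rewrite <- (Rmult_1_r (ep2 * / L)) at 2. apply Rmult_le_compat_l; [nra|easy]. }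
    assert (eLx' : ep2 * / L <= ep2) by nra.
    assert (rLx : r / L * (x - T) <= r).
    { unfold Rdiv. rewrite Rmult_assoc. rewrite <- (Rmult_1_r r) at 2. now apply Rmult_le_compat_l. }
    assert (tot0 : 0 <= ep2 * / L * / L * (x - T)) by (apply Rmult_le_pos; lra).
    eapply Rle_trans.
    - apply (wave_comparison V Q q s (r / L) (ep2 * / L * / L) (exp (r / (2 * s0)) * sqrt (2 * A2)) T x
        e al be kap u u1); try lra; auto.
      + unfold kap, e. rewrite frequency_square by lra.
        assert (P2 : 0 < 4 * s ^ 2 * L ^ 2).
        { generalize (pow_lt s 2 ltac:(lra)) (pow_lt L 2 ltac:(lra)). nra. }
        rewrite Cmod_div, Cmod_mult, Cmod_RtoC_pos; [|lra|intros E; apply RtoC_inj in E; lra].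
        replace (ep2 * / L * / L) with (r ^ 2 / (4 * s0 ^ 2 * L ^ 2)) by (unfold ep2; field; lra).
        unfold Rdiv. apply Rmult_le_compat.
        * apply Rmult_le_pos; apply Cmod_ge_0.
        * left; now apply Rinv_0_lt_compat.
        * generalize (Cmod_ge_0 a); nra.
        * generalize (pow_lt s0 2 ltac:(lra)) (pow_lt L 2 ltac:(lra)) (pow_incr s0 s 2 ltac:(lra)). intros.
          apply Rinv_le_contravar; nra.
      + intros t Ht. destruct (HQ t) as [B1 [B2 _]]; [lra|]. now split.
      + intros t Ht. apply Hu. lra.
      + intros t Ht. apply WS; lra.
    - fold d d1. rewrite Rpow_mult_distr, pow2_sqrt by lra.
      apply Rmult_le_compat.
      + left; apply exp_pos.
      + apply Rplus_le_le_0_compat; [apply energy_ge_0|].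
        apply Rmult_le_pos; [|lra]. apply Rmult_le_pos; [apply pow2_ge_0|lra].
      + apply exp_le. apply Rplus_le_compat; [|lra].
        unfold Rdiv. apply Rmult_le_compat.
        * apply Rplus_le_le_0_compat; [lra|]. apply Rmult_le_pos; lra.
        * left; apply Rinv_0_lt_compat; lra.
        * fold (r / L). lra.
        * apply Rinv_le_contravar; lra.
      + apply Rplus_le_compat; [exact D4|].
        apply Rle_trans with (exp (r / (2 * s0)) ^ 2 * (2 * A2) * (I * lam + ep2 * th)).
        * apply Rmult_le_compat_l; [apply Rmult_le_pos; [apply pow2_ge_0|lra]|]. nra.
        * unfold K2.
          replace (2 * exp (r / (2 * s0)) ^ 2 * (I + ep2) * (th + lam) * A2) with
            (exp (r / (2 * s0)) ^ 2 * (2 * A2) * ((I + ep2) * (th + lam))) by ring.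
          apply Rmult_le_compat_l; [apply Rmult_le_pos; [apply pow2_ge_0|lra]|]. nra. }
  unfold energy in D5. fold kap. change (u x - wave al be kap T x)%C with (d x).
  assert (S2 : 0 < s0 ^ 2) by now apply pow_lt.
  apply (Rmult_le_reg_l (s0 ^ 2)); [easy|].
  apply Rle_trans with (s ^ 2 * Cmod (d x) ^ 2).
  { apply Rmult_le_compat_r; [apply pow2_ge_0|]. apply pow_incr; lra. }
  eapply Rle_trans; [|eapply Rle_trans; [exact D5|]].
  { generalize (pow2_ge_0 (Cmod (d1 x))); lra. }
  apply Rle_trans with (E4 * (K1 + K2) * (th + lam) * A2); [|right; field; lra].
  replace (E4 * (K1 * (th * A2) + K2 * (th + lam) * A2)) with (E4 * A2 * (K1 * th + K2 * (th + lam))) by ring.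
  replace (E4 * (K1 + K2) * (th + lam) * A2) with (E4 * A2 * ((K1 + K2) * (th + lam))) by ring.
  apply Rmult_le_compat_l; [apply Rmult_le_pos; lra|]. nra.
Qed.

(** * Integrals of products of free waves *)

Definition cRInt (f : R -> C) (a b : R) : C := @RInt C_R_CompleteNormedModule f a b.
Definition is_cRInt (f : R -> C) (a b : R) (l : C) : Prop :=
  @is_RInt C_R_NormedModule f a b l.

(** The fundamental theorem of calculus, component by component; the derivative
    f' serves only to make f continuous. *)
Lemma is_cRInt_cderiv (F f f' : R -> C) (a b : R) :
  a <= b -> (forall x, a <= x <= b -> cderiv F x (f x) /\ cderiv f x (f' x)) ->
  is_cRInt f a b (F b - F a)%C.
Proof.
  intros Hab H.
  apply (is_RInt_fct_extend_pair (U := R_NormedModule) (V := R_NormedModule)).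
  - apply (is_RInt_derive (V := R_CompleteNormedModule) (fun x => Re (F x)) (fun x => Re (f x)));
      rewrite Rmin_left, Rmax_right by easy; intros x Hx; destruct (H x Hx) as [H1 H2].
    + apply H1.
    + apply (cderiv_continuous _ _ _ H2).
  - apply (is_RInt_derive (V := R_CompleteNormedModule) (fun x => Im (F x)) (fun x => Im (f x)));
      rewrite Rmin_left, Rmax_right by easy; intros x Hx; destruct (H x Hx) as [H1 H2].
    + apply H1.
    + apply (cderiv_continuous _ _ _ H2).
Qed.

Lemma ex_cRInt (f f' : R -> C) (a b : R) :
  a <= b -> (forall x, a <= x <= b -> cderiv f x (f' x)) ->
  is_cRInt f a b (cRInt f a b).
Proof.
  intros Hab H. apply (RInt_correct (V := C_R_CompleteNormedModule)).
  assert (C1 : ex_RInt (V := R_CompleteNormedModule) (fun x => Re (f x)) a b).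
  { apply @ex_RInt_continuous. rewrite Rmin_left, Rmax_right by easy. intros x Hx.
    apply (cderiv_continuous _ _ _ (H x Hx)). }
  assert (C2 : ex_RInt (V := R_CompleteNormedModule) (fun x => Im (f x)) a b).
  { apply @ex_RInt_continuous. rewrite Rmin_left, Rmax_right by easy. intros x Hx.
    apply (cderiv_continuous _ _ _ (H x Hx)). }
  destruct C1 as [l1 H1], C2 as [l2 H2]. exists (l1, l2).
  now apply (is_RInt_fct_extend_pair (U := R_NormedModule) (V := R_NormedModule)).
Qed.

Lemma is_cRInt_bound (f : R -> C) (a b M : R) (l : C) :
  a <= b -> (forall x, a <= x <= b -> Cmod (f x) <= M) -> is_cRInt f a b l ->
  Cmod l <= (b - a) * M.
Proof.
  intros Hab HM Hl. rewrite <- norm_Cmod.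
  apply (norm_RInt_le_const (V := C_R_NormedModule) f a b l M); try easy.
  intros x Hx. rewrite norm_Cmod. now apply HM.
Qed.

Lemma cRInt_mean_value (F f f' : R -> C) (a b M : R) :
  a <= b -> (forall x, a <= x <= b -> cderiv F x (f x) /\ cderiv f x (f' x)) ->
  (forall x, a <= x <= b -> Cmod (f x) <= M) -> Cmod (F b - F a) <= (b - a) * M.
Proof.
  intros Hab H HM. apply is_cRInt_bound with f; try easy. now apply is_cRInt_cderiv with f'.
Qed.

(** Written with sinc, the primitive of cos(mu y) vanishing at 0 needs no case
    distinction between mu = 0 and mu <> 0. *)
Definition sinc_primitive (mu : C) (y : R) : C := (RtoC y * Csinc (mu * RtoC y))%C.

Lemma sinc_primitive_0 (mu : C) : sinc_primitive mu 0 = 0.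
Proof. unfold sinc_primitive; ring. Qed.

Lemma cderiv_sinc_primitive (mu : C) (y : R) :
  cderiv (sinc_primitive mu) y (Ccos (mu * RtoC y)).
Proof.
  destruct (Ceq_dec mu 0) as [->|Hmu].
  - apply cderiv_ext with (fun t => RtoC t).
    { intros t. unfold sinc_primitive, Csinc. rewrite Cmult_0_l.
      destruct Ceq_dec; [ring|easy]. }
    rewrite Cmult_0_l, Ccos_0.
    apply (cderiv_RtoC (fun t => t) y 1). apply @is_derive_id.
  - apply cderiv_ext with (fun t => / mu * Csin (mu * RtoC t))%C.
    { intros t. unfold sinc_primitive, Csinc. destruct (Ceq_dec (RtoC t) 0) as [->|Ht].
      - rewrite Cmult_0_r, Csin_0. destruct Ceq_dec; ring.
      - destruct Ceq_dec as [E|E]; [now destruct (Cmult_neq_0 _ _ Hmu Ht)|].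
        field. split; easy. }
    eapply cderiv_val; [|apply cderiv_scal, cderiv_Csin]. now field.
Qed.

(** Resonant part (difference of the frequencies) and oscillatory part (sum of
    the frequencies) of the product of two waves with the same coefficients. *)
Lemma wave_product (al be : R) (ka kb : C) (T x : R) :
  (wave al be ka T x * wave al be kb T x =
    RtoC ((al ^ 2 + be ^ 2) / 2) * Ccos ((kb - ka) * RtoC (x - T))
    + RtoC ((al ^ 2 - be ^ 2) / 2) * Ccos ((ka + kb) * RtoC (x - T))
    + RtoC (al * be) * Csin ((ka + kb) * RtoC (x - T)))%C.
Proof.
  unfold wave. set (y := RtoC (x - T)).
  replace ((kb - ka) * y)%C with (kb * y - ka * y)%C by ring.
  replace ((ka + kb) * y)%C with (kb * y + ka * y)%C by ring.
  rewrite (Csin_plus (kb * y)).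
  assert (E1 := Ccos_Ccos (kb * y) (ka * y)). assert (E2 := Csin_Csin (kb * y) (ka * y)).
  set (A := Ccos (kb * y - ka * y)) in *. set (B := Ccos (kb * y + ka * y)) in *.
  set (c1 := Ccos (kb * y)) in *. set (c2 := Ccos (ka * y)) in *.
  set (s1 := Csin (kb * y)) in *. set (s2 := Csin (ka * y)) in *.
  transitivity (RtoC al * RtoC al * (c1 * c2) + RtoC be * RtoC be * (s1 * s2)
    + RtoC al * RtoC be * (s1 * c2 + c1 * s2))%C; [ring|].
  rewrite E1, E2.
  unfold Rdiv. rewrite !RtoC_mult, RtoC_plus, RtoC_minus, RtoC_inv; [|lra].
  simpl. rewrite !RtoC_mult. field.
Qed.

Definition wave_product_primitive (al be : R) (ka kb : C) (T x : R) : C :=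
  (RtoC ((al ^ 2 + be ^ 2) / 2) * sinc_primitive (kb - ka) (x - T)
   + RtoC ((al ^ 2 - be ^ 2) / 2) * (/ (ka + kb) * Csin ((ka + kb) * RtoC (x - T)))
   - RtoC (al * be) * (/ (ka + kb) * Ccos ((ka + kb) * RtoC (x - T))))%C.

Lemma cderiv_wave_product_primitive (al be : R) (ka kb : C) (T x : R) :
  (ka + kb <> 0)%C ->
  cderiv (wave_product_primitive al be ka kb T) x (wave al be ka T x * wave al be kb T x)%C.
Proof.
  intros Hs. rewrite wave_product. unfold wave_product_primitive.
  apply (cderiv_shift (fun y =>
    RtoC ((al ^ 2 + be ^ 2) / 2) * sinc_primitive (kb - ka) y
   + RtoC ((al ^ 2 - be ^ 2) / 2) * (/ (ka + kb) * Csin ((ka + kb) * RtoC y))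
   - RtoC (al * be) * (/ (ka + kb) * Ccos ((ka + kb) * RtoC y)))%C T x).
  eapply cderiv_val; [|apply cderiv_minus; [apply cderiv_plus|]; apply cderiv_scal;
    [apply cderiv_sinc_primitive|apply cderiv_scal, cderiv_Csin|apply cderiv_scal, cderiv_Ccos]].
  field. easy.
Qed.

(** Non-resonance: the sum of two frequencies close to s is close to 2s. *)
Lemma frequency_sum_ge (s0 s r L : R) (a b : C) :
  0 < s0 <= s -> 1 <= L -> Cmod a <= r -> Cmod b <= r -> r * / L <= s0 ^ 2 ->
  s0 <= Cmod (frequency s L a + frequency s L b).
Proof.
  intros Hs HL Ha Hb HrL.
  assert (0 < s * L) by (apply Rmult_lt_0_compat; lra).
  eapply Rle_trans; [|eapply Rle_trans; [apply Rle_abs|apply re_le_Cmod]].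
  unfold frequency.
  replace (Re _) with (2 * s + (Re (a / RtoC (2 * s * L))%C + Re (b / RtoC (2 * s * L))%C))
    by (unfold Re; simpl; ring).
  rewrite !Re_div_R by lra.
  assert (A1 := re_le_Cmod a). assert (B1 := re_le_Cmod b).
  apply Rabs_le_between in A1. apply Rabs_le_between in B1.
  assert (s0 <= 2 * s - r * / L * / s).
  { assert (r * / L * / s <= s0); [|lra].
    apply (Rmult_le_reg_r s); [lra|]. rewrite Rmult_assoc, Rinv_l by lra. nra. }
  replace (Re a / (2 * s * L) + Re b / (2 * s * L)) with ((Re a + Re b) / 2 * (/ L * / s)) by (field; lra).
  assert (0 < / L * / s) by (apply Rmult_lt_0_compat; apply Rinv_0_lt_compat; lra).
  assert (- r * (/ L * / s) <= (Re a + Re b) / 2 * (/ L * / s)) by (apply Rmult_le_compat_r; lra).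
  lra.
Qed.

(** The phase difference accumulated over [0,L] is independent of L, which is
    why the argument of sinc is (b - a)/(2s). *)
Lemma frequency_difference (s L : R) (a b : C) :
  0 < s -> 0 < L ->
  ((frequency s L b - frequency s L a) * RtoC L = RtoC (/ (2 * s)) * (b - a))%C.
Proof.
  intros Hs HL. unfold frequency. rewrite !RtoC_mult, RtoC_inv, RtoC_mult by lra.
  assert (RtoC s <> 0) by (intros E; apply RtoC_inj in E; lra).
  assert (RtoC L <> 0) by (intros E; apply RtoC_inj in E; lra).
  field. split; easy.
Qed.

Lemma phase_plus (z w : C) (r1 r2 : R) :
  Rabs (Im z) <= r1 -> Rabs (Im w) <= r2 ->
  Rabs (Im (z + w)%C) <= r1 + r2 /\ Rabs (Im (w - z)%C) <= r1 + r2.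
Proof.
  intros H1 H2. split; unfold Im in *; simpl; apply Rabs_le_between in H1;
    apply Rabs_le_between in H2; apply Rabs_le_between; lra.
Qed.

Lemma sinc_bound (s0 s r L : R) (a b : C) :
  0 < s0 <= s -> 1 <= L -> Cmod a <= r -> Cmod b <= r ->
  Cmod (sinc_primitive (frequency s L b - frequency s L a) L) <= L * exp (r / s0) /\
  forall T, 0 <= T <= L ->
  Cmod (sinc_primitive (frequency s L b - frequency s L a) (L - T)
        - sinc_primitive (frequency s L b - frequency s L a) L) <= T * exp (r / s0).
Proof.
  intros Hs HL Ha Hb.
  set (mu := (frequency s L b - frequency s L a)%C).
  assert (D : forall y, 0 <= y <= L -> Cmod (Ccos (mu * RtoC y)) <= exp (r / s0)).
  { intros y Hy. eapply Rle_trans; [apply Cmod_Ccos_le|]. apply exp_le.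
    replace (mu * RtoC y)%C with (frequency s L b * RtoC y - frequency s L a * RtoC y)%C
      by (unfold mu; ring).
    replace (r / s0) with (r / (2 * s0) + r / (2 * s0)) by (field; lra).
    apply phase_plus; apply frequency_phase; lra. }
  assert (F : forall x, cderiv (sinc_primitive mu) x (Ccos (mu * RtoC x)) /\
     cderiv (fun x => Ccos (mu * RtoC x)) x (- mu * Csin (mu * RtoC x))%C).
  { intros x; split; [apply cderiv_sinc_primitive|apply cderiv_Ccos]. }
  split.
  - replace (sinc_primitive mu L) with (sinc_primitive mu L - sinc_primitive mu 0)%C
      by (rewrite sinc_primitive_0; ring).
    replace (L * exp (r / s0)) with ((L - 0) * exp (r / s0)) by ring.
    eapply cRInt_mean_value; [lra|intros x _; apply F|exact D].
  - intros T HT. rewrite <- Cmod_opp.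
    replace (- (sinc_primitive mu (L - T) - sinc_primitive mu L))%C with
      (sinc_primitive mu L - sinc_primitive mu (L - T))%C by ring.
    replace (T * exp (r / s0)) with ((L - (L - T)) * exp (r / s0)) by ring.
    eapply cRInt_mean_value; [lra|intros x _; apply F|]. intros; apply D; lra.
Qed.

(** The oscillatory part contributes a bounded amount, and replacing L - T by L
    in the resonant part costs the integral of a bounded function over an
    interval of length T. *)
Lemma wave_integral (al be s0 s r T L : R) (a b : C) :
  let ka := frequency s L a in let kb := frequency s L b in
  let A2 := al ^ 2 + be ^ 2 in
  0 < s0 <= s -> 0 <= T <= L -> 1 <= L -> Cmod a <= r -> Cmod b <= r -> r * / L <= s0 ^ 2 ->
  Cmod (wave_product_primitive al be ka kb T L - wave_product_primitive al be ka kb T T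
        - RtoC (A2 / 2) * sinc_primitive (kb - ka) L)
  <= A2 / 2 * (T * exp (r / s0) + (2 * exp (r / s0) + 1) / s0).
Proof.
  intros ka kb A2 Hs HT HL Ha Hb HrL.
  assert (S := frequency_sum_ge s0 s r L a b Hs HL Ha Hb HrL).
  fold ka kb in S. set (sg := (ka + kb)%C) in *.
  assert (Hsg : sg <> 0) by (apply Cmod_gt_0; lra).
  assert (Si : Cmod (/ sg) <= / s0).
  { rewrite Cmod_inv by easy. apply Rinv_le_contravar; lra. }
  assert (Ph : Rabs (Im (sg * RtoC (L - T))%C) <= r / s0).
  { replace (sg * RtoC (L - T))%C with (ka * RtoC (L - T) + kb * RtoC (L - T))%C by (unfold sg; ring).
    replace (r / s0) with (r / (2 * s0) + r / (2 * s0)) by (field; lra).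
    apply phase_plus; apply frequency_phase; lra. }
  apply exp_le in Ph.
  assert (C1 := Rle_trans _ _ _ (Cmod_Ccos_le _) Ph).
  assert (C2 := Rle_trans _ _ _ (Cmod_Csin_le _) Ph).
  destruct (sinc_bound s0 s r L a b Hs HL Ha Hb) as [_ C3]. specialize (C3 T HT).
  fold ka kb in C3.
  unfold wave_product_primitive. fold A2 sg.
  rewrite Rminus_diag, sinc_primitive_0, (Cmult_0_r sg), Ccos_0, Csin_0.
  set (X := exp (r / s0)) in *.
  match goal with |- Cmod ?z <= _ => replace z with
    (RtoC (A2 / 2) * (sinc_primitive (kb - ka) (L - T) - sinc_primitive (kb - ka) L)
      + (RtoC ((al ^ 2 - be ^ 2) / 2) * (/ sg * Csin (sg * RtoC (L - T)))
      + RtoC (al * be) * (/ sg * (1 - Ccos (sg * RtoC (L - T))))))%C by ring end.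
  eapply Rle_trans; [apply Cmod_triangle|].
  replace (A2 / 2 * (T * X + (2 * X + 1) / s0)) with
    (A2 / 2 * (T * X) + (A2 / 2 * (/ s0 * X) + A2 / 2 * (/ s0 * (1 + X)))) by (field; lra).
  assert (HA : 0 <= A2) by (unfold A2; generalize (pow2_ge_0 al) (pow2_ge_0 be); lra).
  assert (0 < / s0) by (apply Rinv_0_lt_compat; lra).
  apply Rplus_le_compat; [|eapply Rle_trans; [apply Cmod_triangle|]; apply Rplus_le_compat];
    rewrite !Cmod_mult, Cmod_R;
    (apply Rmult_le_compat; [apply Rabs_pos| | |]);
    repeat apply Rmult_le_pos; try apply Cmod_ge_0; try lra.
  - rewrite Rabs_pos_eq; lra.
  - apply Rabs_le_between. unfold A2. generalize (pow2_ge_0 al) (pow2_ge_0 be). lra.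
  - apply Rmult_le_compat; try apply Cmod_ge_0; easy.
  - apply Rabs_le_between. unfold A2.
    generalize (pow2_ge_0 (al - be)) (pow2_ge_0 (al + be)). nra.
  - apply Rmult_le_compat; try apply Cmod_ge_0; [easy|].
    eapply Rle_trans; [apply Cmod_minus_le|]. rewrite Cmod_1. lra.
Qed.

(** * Asymptotics of the kernel on one scale *)

Lemma product_difference (z w z' w' : C) (p q : R) :
  Cmod (z - z') <= p -> Cmod (w - w') <= p -> Cmod z' <= q -> Cmod w' <= q ->
  Cmod (z * w - z' * w') <= p ^ 2 + 2 * p * q.
Proof.
  intros H1 H2 H3 H4.
  replace (z * w - z' * w')%C with ((z - z') * (w - w') + ((z - z') * w' + z' * (w - w')))%C by ring.
  eapply Rle_trans; [apply Cmod_triangle|].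
  eapply Rle_trans; [apply Rplus_le_compat_l, Cmod_triangle|].
  rewrite !Cmod_mult.
  generalize (Cmod_ge_0 (z - z')) (Cmod_ge_0 (w - w')) (Cmod_ge_0 z') (Cmod_ge_0 w'). intros.
  assert (Cmod (z - z') * Cmod (w - w') <= p * p) by (apply Rmult_le_compat; easy).
  assert (Cmod (z - z') * Cmod w' <= p * q) by (apply Rmult_le_compat; easy).
  assert (Cmod z' * Cmod (w - w') <= q * p) by (apply Rmult_le_compat; easy).
  nra.
Qed.

Lemma Cminus_plus_cancel (z w : C) : (z - w + w = z)%C.
Proof. ring. Qed.

Lemma small_parameter (c e s : R) : 0 <= c -> 0 < e -> 0 < s ->
  exists tau, 0 < tau <= 1 /\ tau <= s /\ c * tau <= e.
Proof.
  intros Hc He Hs. exists (Rmin 1 (Rmin s (e / (c + 1)))).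
  assert (0 < e / (c + 1)) by (apply Rdiv_lt_0_compat; lra).
  assert (M1 := Rmin_l 1 (Rmin s (e / (c + 1)))).
  assert (M2 := Rmin_r 1 (Rmin s (e / (c + 1)))).
  assert (M3 := Rmin_l s (e / (c + 1))).
  assert (M4 := Rmin_r s (e / (c + 1))).
  repeat split; try lra.
  - repeat apply Rmin_pos; lra.
  - apply Rle_trans with (c * (e / (c + 1))); [apply Rmult_le_compat_l; lra|].
    apply Rle_trans with ((c + 1) * (e / (c + 1))); [apply Rmult_le_compat_r; lra|].
    right; field; lra.
Qed.

(** The integral over [0,L] consists of the part over [0,T], negligible because
    T e^(cT) is small compared with the squared amplitude times L; of the error
    of replacing both solutions by free waves on [T,L]; and of the explicit
    integral of the product of the waves. *)
Lemma kernel_estimate (s0 r v I eps : R) :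
  0 < s0 -> 0 <= r -> 0 <= v -> 0 <= I -> 0 < eps ->
  exists delta, 0 < delta /\
    forall (V : R -> R) (lam T L s : R) (a b : C) (u0 u01 ua ua1 ub ub1 : R -> C),
    bump_regime V v (I * lam) T L -> 0 <= lam <= delta -> smallness s0 r v T L <= delta ->
    s0 <= s -> Cmod a <= r -> Cmod b <= r ->
    neumann V (RtoC (s ^ 2)) L u0 u01 ->
    neumann V (RtoC (s ^ 2) + a / RtoC L) L ua ua1 ->
    neumann V (RtoC (s ^ 2) + b / RtoC L) L ub ub1 ->
    let M := (Re (u0 T) ^ 2 + (Re (u01 T) / s) ^ 2) * L / 2 in
    0 < M /\
    Cmod (cRInt (fun x => ua x * ub x)%C 0 L - RtoC M * Csinc (RtoC (/ (2 * s)) * (b - a)))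
      <= eps * M.
Proof.
  intros Hs0 Hr Hv HI Heps.
  destruct (approximation s0 r v I Hs0 Hr Hv HI) as [K [HK HA]].
  set (Q := exp (r / s0)). set (B := exp (r / (2 * s0)) * sqrt 2).
  assert (HQ : 0 < Q) by apply exp_pos.
  assert (HB0 : 0 <= B) by (apply Rmult_le_pos; [left; apply exp_pos|apply sqrt_pos]).
  assert (HQs : 0 <= (2 * Q + 1) / s0) by (apply Rdiv_le_0_compat; lra).
  set (eta := sqrt (2 * K)). assert (Heta : 0 <= eta) by apply sqrt_pos.
  (* c collects the coefficients of tau in twice the total relative error;
     the approximation error is a square root of delta, hence delta = tau^2 *)
  set (c := 2 + 4 * K + 4 * eta * B + Q + (2 * Q + 1) / s0).
  assert (HeB : 0 <= eta * B) by now apply Rmult_le_pos.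
  destruct (small_parameter c eps (s0 ^ 2 / (r + 1))) as [tau [Ht [Hts Htc]]]; [unfold c; lra|easy| |].
  { apply Rdiv_lt_0_compat; [now apply pow_lt|lra]. }
  assert (Htr : r * tau <= s0 ^ 2).
  { apply Rle_trans with (r * (s0 ^ 2 / (r + 1))); [now apply Rmult_le_compat_l|].
    assert (0 < s0 ^ 2 / (r + 1)) by (apply Rdiv_lt_0_compat; [now apply pow_lt|lra]).
    apply Rle_trans with ((r + 1) * (s0 ^ 2 / (r + 1))); [apply Rmult_le_compat_r; lra|].
    right; field; lra. }
  exists (tau ^ 2). split; [apply pow_lt; lra|].
  intros V lam T L s a b u0 u01 ua ua1 ub ub1 HB Hlam Hth Hs Ha Hb Hu0 Hua Hub M.
  assert (Hlam1 : 0 <= lam <= 1) by nra.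
  assert (G1 := amplitude_lower V s0 s r v (I * lam) T L u0 u01 (conj Hs0 Hs) Hr Hv HB Hu0).
  assert (Aa := HA V lam T L s a ua ua1 u0 u01 HB Hlam1 Hs Ha Hu0 Hua).
  assert (Ab := HA V lam T L s b ub ub1 u0 u01 HB Hlam1 Hs Hb Hu0 Hub).
  destruct (proj1 HB) as [HT0 HTL]. assert (HL := proj1 (proj2 HB)).
  assert (HLn : RtoC L <> 0) by (intros E; apply RtoC_inj in E; lra).
  assert (Qa : forall e, Cmod e <= r -> Cmod (e / RtoC L) <= r / L).
  { intros e He. rewrite Cmod_div, Cmod_RtoC_pos by (easy || lra).
    apply Rmult_le_compat_r; [left; apply Rinv_0_lt_compat|]; lra. }
  assert (Sa := fun t => size_le_gain V s0 s r v (I * lam) T L t _ ua ua1 (conj Hs0 Hs) Hr Hv HB (Qa a Ha) Hua).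
  assert (Sb := fun t => size_le_gain V s0 s r v (I * lam) T L t _ ub ub1 (conj Hs0 Hs) Hr Hv HB (Qa b Hb) Hub).
  set (al := Re (u0 T)) in *. set (be := Re (u01 T) / s) in *.
  set (A2 := al ^ 2 + be ^ 2) in *.
  set (X := gain s0 r v T) in *.
  assert (X1 : 1 <= X) by (apply gain_ge_1; lra).
  set (th := smallness s0 r v T L) in *.
  assert (HA2 : 0 < A2) by nra.
  assert (X3 : 1 <= X ^ 3) by (apply pow_R1_Rle; lra).
  assert (thL : th * L = X ^ 3 * (1 + T)) by (unfold th, smallness; fold X; field; lra).
  assert (Lth : 1 <= th * L) by nra.
  assert (Tth : T <= th * L) by nra.
  assert (iL : / L <= th).
  { apply (Rmult_le_reg_r L); [lra|]. rewrite Rinv_l; lra. }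
  assert (XT : T * X <= A2 * (th * L)).
  { rewrite thL. apply Rle_trans with (X ^ 2 * (1 + T) * (X * A2)); [|right; ring].
    apply Rle_trans with (X ^ 2 * (1 + T)); [nra|].
    rewrite <- (Rmult_1_r (X ^ 2 * (1 + T))) at 1. apply Rmult_le_compat_l; [nra|easy]. }
  assert (Mpos : 0 < M) by (unfold M; fold al be A2; nra).
  split; [easy|].
  set (ka := frequency s L a) in *. set (kb := frequency s L b) in *.
  assert (Hsg : (ka + kb)%C <> 0).
  { apply Cmod_gt_0. apply Rlt_le_trans with s0; [easy|]. apply frequency_sum_ge with r; try lra; nra. }
  (* J1: integral over [0,T]; J3: error of the wave approximation on [T,L];
     J2: exact integral of the product of the waves *)
  set (F := (fun x => ua x * ub x)%C).
  set (P := (fun x => wave al be ka T x * wave al be kb T x)%C).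
  assert (DF : forall x, 0 <= x <= L -> cderiv F x (ua1 x * ub x + ua x * ub1 x)%C).
  { intros x Hx. apply cderiv_mult; [apply Hua|apply Hub]; easy. }
  assert (DP : forall x, cderiv P x (wave (ka * be) (- (ka * al)) ka T x * wave al be kb T x
     + wave al be ka T x * wave (kb * be) (- (kb * al)) kb T x)%C).
  { intros x. apply cderiv_mult; apply cderiv_wave. }
  assert (I1 := ex_cRInt F _ 0 T HT0 (fun x Hx => DF x ltac:(lra))).
  assert (I2 := is_cRInt_cderiv (wave_product_primitive al be ka kb T) P _ T L HTL
      (fun x _ => conj (cderiv_wave_product_primitive al be ka kb T x Hsg) (DP x))).
  assert (I3 := ex_cRInt (fun x => F x - P x)%C _ T L HTL
      (fun x Hx => cderiv_minus _ _ x _ _ (DF x ltac:(lra)) (DP x))).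
  set (J1 := cRInt F 0 T) in *. set (J3 := cRInt (fun x => F x - P x)%C T L) in *.
  set (J2 := (wave_product_primitive al be ka kb T L - wave_product_primitive al be ka kb T T)%C) in *.
  assert (I23 : is_cRInt F T L (J3 + J2)%C).
  { apply (is_RInt_ext (V := C_R_NormedModule) (fun x => (F x - P x) + P x)%C).
    { intros x _. apply (Cminus_plus_cancel (F x) (P x)). }
    exact (is_RInt_plus (V := C_R_NormedModule) _ _ _ _ _ _ I3 I2). }
  assert (I123 : cRInt F 0 L = (J1 + (J3 + J2))%C).
  { apply (is_RInt_unique (V := C_R_CompleteNormedModule)).
    exact (is_RInt_Chasles (V := C_R_NormedModule) _ _ _ _ _ _ I1 I23). }
  assert (B1 : Cmod J1 <= T * X).
  { replace (T * X) with ((T - 0) * X) by ring.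
    apply is_cRInt_bound with F; try easy. intros x Hx. unfold F. rewrite Cmod_mult.
    specialize (Sa x Hx). specialize (Sb x Hx).
    generalize (pow2_ge_0 (Cmod (ua x) - Cmod (ub x))). nra. }
  assert (HtL : 0 <= th + lam <= 2 * tau ^ 2).
  { assert (0 <= th) by (assert (0 < / L) by (apply Rinv_0_lt_compat; lra); lra). lra. }
  assert (App : forall z : R, 0 <= z -> z ^ 2 <= K * (th + lam) * A2 -> z <= eta * tau * sqrt A2).
  { intros z Hz Hz2. apply Rsqr_incr_0_var.
    - rewrite !Rsqr_pow2, !Rpow_mult_distr. unfold eta. rewrite !pow2_sqrt by lra.
      eapply Rle_trans; [exact Hz2|]. apply Rmult_le_compat_r; [lra|]. nra.
    - repeat apply Rmult_le_pos; try lra; apply sqrt_pos. }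
  assert (W : forall e x, Cmod e <= r -> T <= x <= L ->
     Cmod (wave al be (frequency s L e) T x) <= B * sqrt A2).
  { intros e x He Hx. unfold B. rewrite Rmult_assoc, <- sqrt_mult by lra.
    apply wave_size; [unfold A2; lra|]. apply frequency_phase; lra. }
  assert (B3 : Cmod J3 <= (L - T) * ((eta * tau * sqrt A2) ^ 2 + 2 * (eta * tau * sqrt A2) * (B * sqrt A2))).
  { apply is_cRInt_bound with (fun x => F x - P x)%C; try easy. intros x Hx.
    apply product_difference.
    - apply App; [apply Cmod_ge_0|]. now apply Aa.
    - apply App; [apply Cmod_ge_0|]. now apply Ab.
    - now apply W.
    - now apply W. }
  assert (B2 := wave_integral al be s0 s r T L a b (conj Hs0 Hs) (conj HT0 HTL) HL Ha Hb ltac:(nra)).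
  fold ka kb A2 J2 Q in B2.
  rewrite I123.
  assert (E : (RtoC M * Csinc (RtoC (/ (2 * s)) * (b - a)) = RtoC (A2 / 2) * sinc_primitive (kb - ka) L)%C).
  { unfold sinc_primitive, ka, kb. rewrite frequency_difference by lra.
    unfold M. fold al be A2. replace (A2 * L / 2) with (A2 / 2 * L) by field. rewrite RtoC_mult. ring. }
  rewrite E. set (S := (RtoC (A2 / 2) * sinc_primitive (kb - ka) L)%C) in *.
  replace (J1 + (J3 + J2) - S)%C with (J1 + (J3 + (J2 - S)))%C by ring.
  eapply Rle_trans; [apply Cmod_triangle|].
  eapply Rle_trans; [apply Rplus_le_compat_l, Cmod_triangle|].
  assert (SA : sqrt A2 * sqrt A2 = A2) by (apply sqrt_sqrt; lra).
  assert (B3' : Cmod J3 <= A2 * L * (2 * K * tau ^ 2 + 2 * eta * tau * B)).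
  { eapply Rle_trans; [exact B3|].
    replace ((eta * tau * sqrt A2) ^ 2 + 2 * (eta * tau * sqrt A2) * (B * sqrt A2)) with
      ((sqrt A2 * sqrt A2) * (eta ^ 2 * tau ^ 2 + 2 * eta * tau * B)) by ring.
    rewrite SA. unfold eta at 1. rewrite pow2_sqrt by lra.
    assert (0 <= A2 * (2 * K * tau ^ 2 + 2 * eta * tau * B)).
    { apply Rmult_le_pos; [lra|]. nra. }
    nra. }
  assert (B1' : Cmod J1 <= A2 * L * tau ^ 2).
  { eapply Rle_trans; [exact B1|]. eapply Rle_trans; [exact XT|]. 
    replace (A2 * L * tau ^ 2) with (A2 * (tau ^ 2 * L)) by ring.
    apply Rmult_le_compat_l; [lra|]. apply Rmult_le_compat_r; lra. }
  assert (B2' : Cmod (J2 - S) <= A2 * L * (tau ^ 2 / 2 * (Q + (2 * Q + 1) / s0))).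
  { eapply Rle_trans; [exact B2|].
    replace (A2 * L * (tau ^ 2 / 2 * (Q + (2 * Q + 1) / s0))) with
      (A2 / 2 * (tau ^ 2 * L * Q + tau ^ 2 * L * ((2 * Q + 1) / s0))) by (field; lra).
    apply Rmult_le_compat_l; [lra|].
    assert (th * L <= tau ^ 2 * L) by (apply Rmult_le_compat_r; lra).
    apply Rplus_le_compat; [apply Rmult_le_compat_r; lra|].
    rewrite <- (Rmult_1_l ((2 * Q + 1) / s0)) at 1. apply Rmult_le_compat_r; lra. }
  apply Rle_trans with (A2 * L * (tau * c / 2)).
  - apply Rle_trans with (A2 * L * (tau ^ 2 + (2 * K * tau ^ 2 + 2 * eta * tau * B)
       + tau ^ 2 / 2 * (Q + (2 * Q + 1) / s0))); [lra|].
    apply Rmult_le_compat_l; [nra|]. unfold c.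
    assert (tau ^ 2 <= tau) by nra. set (q := (2 * Q + 1) / s0) in *.
    assert (tau ^ 2 * K <= tau * K) by (apply Rmult_le_compat_r; lra).
    assert (tau ^ 2 * (Q + q) <= tau * (Q + q)) by (apply Rmult_le_compat_r; lra).
    lra.
  - unfold M. fold al be A2. replace (A2 * L * (tau * c / 2)) with (c * tau * (A2 * L / 2)) by field.
    apply Rmult_le_compat_r; [nra|easy].
Qed.

(** * Sparse potentials and uniformity *)

(** With separated bumps at most one term of the potential is nonzero at any
    point. *)
Lemma Series_single (a : nat -> R) (k : nat) :
  (forall n, n <> k -> a n = 0) -> Series a = a k.
Proof.
  intros H.
  assert (E : forall n, sum_n a n = if le_dec k n then a k else 0).
  { induction n as [|n IH].
    - rewrite sum_O. destruct le_dec as [Hk|Hk].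
      + f_equal; lia.
      + apply H; lia.
    - rewrite sum_Sn, IH. unfold plus; simpl. repeat destruct le_dec; try lia.
      + rewrite (H (S n)) by lia. ring.
      + replace k with (S n) by lia. ring.
      + rewrite (H (S n)) by lia. ring. }
  apply is_series_unique. unfold is_series.
  apply (is_lim_seq_ext_loc (fun _ => a k) (sum_n a) (a k)); [|apply is_lim_seq_const].
  exists k. intros n Hn. rewrite E. destruct le_dec; [easy|lia].
Qed.

(** A gap of 2 leaves room for the support [N k, N k + 1] of a bump and for a
    point N k + 2 strictly beyond it, so that the values of W at the end points
    of its support never matter. *)
Definition spaced (N : nat -> R) : Prop := forall k, N k + 2 < N (S k).

Lemma spaced_lt (N : nat -> R) (n m : nat) : spaced N -> (n < m)%nat -> N n + 2 < N m.
Proof.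
  intros H Hnm. induction m as [|m IH]; [lia|].
  assert (n = m \/ (n < m)%nat) as [->|Hm] by lia; [apply H|].
  generalize (H m) (IH Hm); lra.
Qed.

Lemma spaced_le (N : nat -> R) (n m : nat) : spaced N -> (n <= m)%nat -> N n <= N m.
Proof.
  intros H Hnm. assert (n = m \/ (n < m)%nat) as [->|Hm] by lia; [lra|].
  generalize (spaced_lt N n m H Hm); lra.
Qed.

Lemma potential_near (W : R -> R) (lam N : nat -> R) (k : nat) (x : R) :
  spaced N -> (forall y, W y <> 0 -> 0 <= y <= 1) ->
  N k + 2 <= x < N (S (S k)) ->
  potential W lam N x = lam (S k) * W (x - N (S k)).
Proof.
  intros HN HW Hx. apply (Series_single (fun n => lam n * W (x - N n)) (S k)).
  intros n Hn. destruct (Req_dec (W (x - N n)) 0) as [->|E]; [ring|].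
  apply HW in E. exfalso.
  assert (n <= k \/ S (S k) <= n)%nat as [Hnk|Hnk] by lia.
  - generalize (spaced_le N _ _ HN Hnk); lra.
  - generalize (spaced_le N _ _ HN Hnk); lra.
Qed.

Lemma potential_bound (W : R -> R) (lam N : nat -> R) (w l x : R) :
  spaced N -> (forall y, W y <> 0 -> 0 <= y <= 1) ->
  (forall y, Rabs (W y) <= w) -> (forall n, Rabs (lam n) <= l) ->
  Rabs (potential W lam N x) <= l * w.
Proof.
  intros HN HW Hw Hl.
  assert (E : exists k, potential W lam N x = lam k * W (x - N k)).
  { destruct (classic (exists k, W (x - N k) <> 0)) as [[k Hk]|Hk].
    - exists k. apply (Series_single (fun n => lam n * W (x - N n))). intros n Hn.
      destruct (Req_dec (W (x - N n)) 0) as [->|E]; [ring|].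
      apply HW in E. apply HW in Hk. exfalso.
      assert (n < k \/ k < n)%nat as [Hnk|Hnk] by lia;
        generalize (spaced_lt N _ _ HN Hnk); lra.
    - exists O. apply (Series_single (fun n => lam n * W (x - N n))). intros n Hn.
      destruct (Req_dec (W (x - N n)) 0) as [->|E]; [ring|]. exfalso; eauto. }
  destruct E as [k ->]. rewrite Rabs_mult.
  apply Rmult_le_compat; auto using Rabs_pos.
Qed.

Lemma bump_continuous (W : R -> R) : smooth W -> forall x, continuous W x.
Proof. intros H x. apply @ex_derive_continuous. exact (H 1%nat x). Qed.

Lemma bump_bounded (W : R -> R) :
  smooth W -> (forall y, W y <> 0 -> 0 <= y <= 1) ->
  exists w, 0 <= w /\ forall y, Rabs (W y) <= w.
Proof.
  intros HW HS.
  destruct (continuity_ab_maj (fun y => Rabs (W y)) 0 1) as [m [Hm _]]; [lra| |].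
  - intros c _. apply continuity_pt_filterlim.
    apply (continuous_comp W Rabs); [now apply bump_continuous|apply continuous_Rabs].
  - exists (Rabs (W m)). split; [apply Rabs_pos|]. intros y.
    destruct (Req_dec (W y) 0) as [->|E]; [rewrite Rabs_R0; apply Rabs_pos|].
    apply Hm. now apply HS.
Qed.

(** Any bounded primitive would do: it measures the mass of a translated bump
    on an arbitrary interval by the single constant I. *)
Lemma bump_primitive (W : R -> R) :
  smooth W -> (forall y, 0 <= W y) -> (forall y, W y <> 0 -> 0 <= y <= 1) ->
  exists (I : R) (M : R -> R), 0 <= I /\ forall y, is_derive M y (W y) /\ 0 <= M y <= I.
Proof.
  intros HW Hp HS. assert (HC := bump_continuous W HW).
  assert (HI : forall a b, ex_RInt W a b).
  { intros a b. apply @ex_RInt_continuous. intros; apply HC. }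
  assert (HD : forall y, is_derive (RInt W 0) y (W y)).
  { intros y. apply is_derive_RInt with 0; [|apply HC].
    apply filter_forall. intros t. apply (RInt_correct (V := R_CompleteNormedModule)), HI. }
  assert (Z : forall a b, a <= b -> (b <= 0 \/ 1 <= a) -> RInt W a b = 0).
  { intros a b Hab H. rewrite (RInt_ext W (fun _ => 0)).
    - rewrite RInt_const. unfold scal; simpl; unfold mult; simpl; ring.
    - rewrite Rmin_left, Rmax_right by easy. intros x Hx.
      destruct (Req_dec (W x) 0) as [E|E]; [easy|]. apply HS in E. lra. }
  assert (Mono : forall a b, a <= b -> RInt W 0 a <= RInt W 0 b).
  { intros a b Hab. apply (nondecreasing_of_derivative _ W); auto. }
  assert (Z0 : RInt W 0 0 = 0) by (apply Z; lra).
  exists (RInt W 0 1), (RInt W 0). split; [generalize (Mono 0 1); lra|].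
  intros y. split; [apply HD|].
  assert (Hneg : forall t, t <= 0 -> RInt W 0 t = 0).
  { intros t Ht. rewrite <- (opp_RInt_swap W) by apply HI.
    rewrite Z by lra. unfold opp; simpl; ring. }
  assert (Hbig : forall t, 1 <= t -> RInt W 0 t = RInt W 0 1).
  { intros t Ht. rewrite <- (RInt_Chasles W 0 1 t) by apply HI.
    rewrite (Z 1 t) by lra. unfold plus; simpl; ring. }
  split.
  - destruct (Rle_dec y 0); [rewrite Hneg; lra|]. generalize (Mono 0 y); lra.
  - destruct (Rle_dec 1 y); [rewrite Hbig; lra|]. apply Mono; lra.
Qed.

Lemma sequence_bounded (lam : nat -> R) : is_lim_seq lam 0 -> exists l, 0 <= l /\ forall n, Rabs (lam n) <= l.
Proof.
  intros H. apply is_lim_seq_Reals in H.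
  destruct (maj_by_pos lam (exist _ 0 H)) as [l [Hl Hb]].
  exists l; split; [lra|exact Hb].
Qed.

Lemma bump_regime_potential (W : R -> R) (lam N : nat -> R) (w l I : R) (M : R -> R) (k : nat) (L : R) :
  spaced N -> (forall n, 0 < N n) -> (forall y, 0 <= W y) -> (forall y, W y <> 0 -> 0 <= y <= 1) ->
  (forall y, Rabs (W y) <= w) -> (forall n, Rabs (lam n) <= l) ->
  (forall y, is_derive M y (W y) /\ 0 <= M y <= I) ->
  N (S k) <= L < N (S (S k)) ->
  bump_regime (potential W lam N) (l * w) (I * Rabs (lam (S k))) (N k + 2) L.
Proof.
  intros HN Hpos Hp HS Hw Hl HM HL.
  assert (H0 := Hpos k). assert (H1 := HN k).
  split; [lra|split; [lra|split]].
  - intros t _. now apply potential_bound.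
  - exists (fun t => Rabs (lam (S k)) * M (t - N (S k))), (fun t => Rabs (lam (S k)) * W (t - N (S k))).
    intros t Ht. split; [|split].
    + rewrite (potential_near W lam N k) by (easy || lra).
      rewrite Rabs_mult, (Rabs_pos_eq (W _)) by easy. lra.
    + apply is_derive_scal. evar_last.
      * apply (is_derive_comp M (fun t => t - N (S k))); [apply HM|].
        auto_derive; [easy|reflexivity].
      * unfold scal; simpl; unfold mult; simpl; ring.
    + destruct (HM (t - N (S k))) as [_ M1]. destruct (HM (N k + 2 - N (S k))) as [_ M2].
      rewrite <- Rmult_minus_distr_l, (Rmult_comm I).
      apply Rmult_le_compat_l; [apply Rabs_pos|lra].
Qed.

Lemma locate (N : nat -> R) (m : nat) (L : R) :
  spaced N -> N m <= L -> exists k, (m <= k)%nat /\ N k <= L < N (S k).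
Proof.
  intros HN Hm.
  assert (G : forall n, INR n + N 0%nat <= N n).
  { induction n as [|n IH]; [simpl; lra|]. rewrite S_INR. generalize (HN n); lra. }
  assert (K : forall n, L < N n -> exists k, (m <= k)%nat /\ N k <= L < N (S k)).
  { induction n as [|n IH]; intros Hn.
    - generalize (spaced_le N 0 m HN (Nat.le_0_l m)); lra.
    - destruct (Rlt_le_dec L (N n)) as [Hl|Hl]; [now apply IH|].
      exists n. split; [|lra].
      destruct (le_lt_dec m n) as [|Hlt]; [easy|].
      generalize (spaced_le N (S n) m HN Hlt); lra. }
  destruct (INR_unbounded (L - N 0%nat)) as [n Hn]. apply (K n). generalize (G n); lra.
Qed.

(** Exponential growth with a rate that increases with the index eventually
    beats every fixed rate, so the threshold need not know the compact sets. *)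
Definition threshold (l : list R) : R := exp (INR (length l) * (last l 0 + 2)).

Lemma sparse_threshold (N : nat -> R) :
  sparse threshold N -> forall k, exp (INR (S k) * (N k + 2)) <= N (S k).
Proof.
  intros H k. specialize (H k). unfold threshold in H.
  rewrite length_map, length_seq, seq_S, map_app in H. simpl map in H.
  now rewrite last_last in H.
Qed.

Lemma sparse_spaced (N : nat -> R) :
  (forall n, 0 < N n) -> sparse threshold N -> spaced N.
Proof.
  intros Hp H k. apply Rlt_le_trans with (2 := sparse_threshold N H k).
  assert (X := Hp k). assert (1 <= INR (S k)) by (rewrite S_INR; generalize (pos_INR k); lra).
  apply Rlt_le_trans with (1 + INR (S k) * (N k + 2)); [nra|]. apply exp_ineq1_le.
Qed.

(** With c = (v + r)/s0, the smallness is at most exp((3c + 1) T) / L, hence at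
    most exp(-(k - 3c) T), and T >= 1. *)
Lemma smallness_eventually (s0 r v delta : R) :
  0 < s0 -> 0 <= r -> 0 <= v -> 0 < delta ->
  exists k0 : nat, forall (k : nat) (T L : R), (k0 <= k)%nat -> 1 <= T ->
    exp (INR (S k) * T) <= L -> smallness s0 r v T L <= delta.
Proof.
  intros Hs0 Hr Hv Hd.
  set (c := (v + r) / s0).
  assert (Hdi : 0 < / delta) by now apply Rinv_0_lt_compat.
  destruct (INR_unbounded (3 * c + / delta)) as [k0 Hk0].
  exists k0. intros k T L Hk HT HL. apply le_INR in Hk.
  assert (X := exp_pos (INR (S k) * T)).
  unfold smallness, gain. fold c.
  apply (Rmult_le_reg_r L); [lra|]. unfold Rdiv. rewrite Rmult_assoc, Rinv_l, Rmult_1_r by lra.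
  apply Rle_trans with (delta * exp (INR (S k) * T)); [|apply Rmult_le_compat_l; lra].
  apply Rle_trans with (exp (c * T) ^ 3 * exp T).
  { apply Rmult_le_compat_l; [apply pow_le; left; apply exp_pos|apply exp_ineq1_le]. }
  replace (exp (c * T) ^ 3 * exp T) with (exp (3 * c * T + T)).
  2:{ simpl. rewrite Rmult_1_r, <- !exp_plus. f_equal; ring. }
  apply Rle_trans with (delta * (exp (/ delta) * exp (3 * c * T + T))).
  - assert (E := exp_ineq1_le (/ delta)).
    assert (Y := exp_pos (3 * c * T + T)).
    rewrite <- Rmult_assoc. rewrite <- (Rmult_1_l (exp (3 * c * T + T))) at 1.
    apply Rmult_le_compat_r; [lra|].
    rewrite <- (Rinv_r delta) by lra. apply Rmult_le_compat_l; lra.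
  - apply Rmult_le_compat_l; [lra|]. rewrite <- exp_plus. apply exp_le.
    rewrite S_INR. nra.
Qed.

Lemma compact_positive_bound (K : R -> Prop) :
  compact K -> (forall x, K x -> 0 < x) -> exists m, 0 < m /\ forall x, K x -> m <= x.
Proof.
  intros HK Hp. apply compact_P2 in HK.
  destruct (HK 0) as [d Hd].
  { intros H0. generalize (Hp 0 H0). lra. }
  exists d. split; [apply cond_pos|]. intros x Hx.
  destruct (Rle_lt_dec d x) as [|Hlt]; [easy|]. exfalso.
  apply (Hd x); [|easy]. unfold disc. rewrite Rminus_0_r, Rabs_pos_eq; [easy|].
  generalize (Hp x Hx); lra.
Qed.

(** An increasing open cover of C by bounded sets. *)
Definition box (n : nat) (z : C) : Prop := Rabs (Re z) < INR n /\ Rabs (Im z) < INR n.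

Lemma open_box (n : nat) : open (box n).
Proof.
  intros z [H1 H2].
  assert (P : 0 < Rmin (INR n - Rabs (Re z)) (INR n - Rabs (Im z))) by (apply Rmin_pos; lra).
  exists (mkposreal _ P). intros w [B1 B2].
  unfold ball in B1, B2; simpl in B1, B2; unfold AbsRing_ball, abs, minus, plus, opp in B1, B2; simpl in B1, B2.
  assert (M1 := Rmin_l (INR n - Rabs (Re z)) (INR n - Rabs (Im z))).
  assert (M2 := Rmin_r (INR n - Rabs (Re z)) (INR n - Rabs (Im z))).
  assert (T1 := Rabs_triang_inv (fst w) (fst z)). assert (T2 := Rabs_triang_inv (snd w) (snd z)).
  unfold box, Re, Im in *. unfold Rminus in *. lra.
Qed.

Lemma Ccompact_bounded (A : C -> Prop) :
  Ccompact A -> exists r, 0 <= r /\ forall a, A a -> Cmod a <= r.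
Proof.
  intros HA.
  destruct (HA (fun U => exists n, U = box n)) as [l [Hl Hc]].
  - intros U [n ->]. apply open_box.
  - intros z _. destruct (INR_unbounded (Rabs (Re z) + Rabs (Im z))) as [n Hn].
    exists (box n). split; [now exists n|].
    generalize (Rabs_pos (Re z)) (Rabs_pos (Im z)). split; lra.
  - assert (E : exists r, 0 <= r /\ forall U, In U l -> forall z, U z -> Cmod z <= r).
    { clear Hc. induction l as [|U l IH].
      - exists 0. split; [lra|easy].
      - destruct IH as [r [Hr0 Hr]]; [intros V HV; apply Hl; now right|].
        destruct (Hl U (or_introl eq_refl)) as [n ->].
        exists (r + (INR n + INR n)). assert (P := pos_INR n). split; [lra|].
        intros U [<-|HU] z Hz.
        + destruct Hz as [Z1 Z2].
          replace z with (RtoC (Re z) + RtoC (Im z) * Ci)%C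
            by (apply C_eq; unfold Re, Im; simpl; ring).
          eapply Rle_trans; [apply Cmod_triangle|].
          rewrite Cmod_mult, Cmod_Ci, !Cmod_R. lra.
        + generalize (Hr U HU z Hz). lra. }
    destruct E as [r [Hr0 Hr]]. exists r. split; [easy|].
    intros a Ha. destruct (Hc a Ha) as [U [HU1 HU2]]. eauto.
Qed.

(** Both numerator and denominator are known up to the same unknown factor M,
    which cancels. *)
Lemma ratio_estimate (X Y z : C) (M eta q : R) :
  0 < M -> 0 <= eta <= / 2 -> Cmod z <= q ->
  Cmod (X - RtoC M * z) <= eta * M -> Cmod (Y - RtoC M) <= eta * M ->
  Cmod (X / Y - z) <= 2 * eta * (1 + q).
Proof.
  intros HM He Hz HX HY.
  assert (YM : M / 2 <= Cmod Y).
  { assert (T := Cmod_triangle Y (- (Y - RtoC M))).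
    replace (Y + - (Y - RtoC M))%C with (RtoC M) in T by ring.
    rewrite Cmod_opp, Cmod_RtoC_pos in T by lra.
    assert (eta * M <= / 2 * M) by (apply Rmult_le_compat_r; lra). lra. }
  assert (Y0 : Y <> 0) by (apply Cmod_gt_0; lra).
  replace (X / Y - z)%C with (((X - RtoC M * z) - z * (Y - RtoC M)) / Y)%C by (field; easy).
  rewrite Cmod_div by easy.
  apply (Rmult_le_reg_r (Cmod Y)); [lra|].
  unfold Rdiv. rewrite Rmult_assoc, Rinv_l, Rmult_1_r by lra.
  eapply Rle_trans; [apply Cmod_minus_le|]. rewrite Cmod_mult.
  assert (0 <= Cmod z) by apply Cmod_ge_0.
  apply Rle_trans with (2 * eta * (1 + q) * (M / 2)).
  - assert (Cmod z * Cmod (Y - RtoC M) <= q * (eta * M)).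
    { apply Rmult_le_compat; auto using Cmod_ge_0. }
    lra.
  - apply Rmult_le_compat_l; [|easy]. apply Rmult_le_pos; lra.
Qed.

Lemma Csinc_0 : Csinc 0 = 1.
Proof. unfold Csinc. destruct Ceq_dec; easy. Qed.

Lemma Csinc_bound (s0 s r : R) (a b : C) :
  0 < s0 <= s -> Cmod a <= r -> Cmod b <= r ->
  Cmod (Csinc (RtoC (/ (2 * s)) * (b - a))) <= exp (r / s0).
Proof.
  intros Hs Ha Hb.
  destruct (sinc_bound s0 s r 1 a b Hs (Rle_refl 1) Ha Hb) as [H _].
  unfold sinc_primitive in H. rewrite frequency_difference in H by lra.
  rewrite Cmult_1_l, Rmult_1_l in H. exact H.
Qed.

Lemma CD_kernel_eq (u : C -> R -> C) (L : R) (z w : C) (v v' : R -> C) :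
  0 <= L -> (forall x, 0 <= x -> v x = u z x) -> (forall x, 0 <= x -> v' x = u w x) ->
  CD_kernel u L z w = cRInt (fun x => v x * v' x)%C 0 L.
Proof.
  intros HL Hv Hw. apply (RInt_ext (V := C_R_CompleteNormedModule)).
  rewrite Rmin_left, Rmax_right by easy. intros x Hx. now rewrite Hv, Hw by lra.
Qed.

Theorem theorem1p5 :
  forall (W : R -> R) (lam : nat -> R),
    smooth W ->
    (forall x : R, 0 <= W x) ->
    (forall x : R, W x <> 0 -> 0 <= x <= 1) ->
    is_lim_seq lam 0 ->
    exists Ntilde : list R -> R,
      forall N : nat -> R,
        (forall n : nat, 0 < N n) ->
        sparse Ntilde N ->
        forall u : C -> R -> C,
          (forall xi : C, neumann_solution (potential W lam N) xi (u xi)) ->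
          forall (K : R -> Prop) (A B : C -> Prop),
            compact K -> (forall xi : R, K xi -> 0 < xi) ->
            Ccompact A -> (forall a : C, A a -> Rabs (Im a) <= 1) ->
            Ccompact B -> (forall b : C, B b -> Rabs (Im b) <= 1) ->
            forall eps : R, 0 < eps ->
              Rbar_locally p_infty (fun L : R =>
                forall (xi : R) (a b : C), K xi -> A a -> B b ->
                  Cmod (CD_kernel u L (RtoC xi + a / RtoC L)
                                      (RtoC xi + b / RtoC L)
                        / CD_kernel u L (RtoC xi) (RtoC xi)
                        - Csinc (RtoC (PI * density xi) * (b - a)))%C < eps).
Proof.
  intros W lam HW Hp HS Hlam. exists threshold.
  intros N HN Hsp u Hu K A B HK HKp HA _ HB _ eps Heps.
  assert (Sp := sparse_spaced N HN Hsp).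
  destruct (bump_bounded W HW HS) as [w [Hw0 Hw]].
  destruct (bump_primitive W HW Hp HS) as [I [M [HI HM]]].
  destruct (sequence_bounded lam Hlam) as [l [Hl0 Hl]].
  destruct (compact_positive_bound K HK HKp) as [m [Hm0 Hm]].
  destruct (Ccompact_bounded A HA) as [ra [Hra0 Hra]].
  destruct (Ccompact_bounded B HB) as [rb [Hrb0 Hrb]].
  set (s0 := sqrt m). assert (Hs0 : 0 < s0) by now apply sqrt_lt_R0.
  set (r := ra + rb). assert (Hr : 0 <= r) by (unfold r; lra).
  set (v := l * w). assert (Hv : 0 <= v) by now apply Rmult_le_pos.
  set (q := exp (r / s0)). assert (Hq : 0 < q) by apply exp_pos.
  destruct (small_parameter (2 * (1 + q)) (eps / 2) (/ 2)) as [eta [He1 [He2 He3]]]; try lra.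
  destruct (kernel_estimate s0 r v I eta Hs0 Hr Hv HI (proj1 He1)) as [delta [Hd Ker]].
  destruct (smallness_eventually s0 r v delta Hs0 Hr Hv Hd) as [k0 Hk0].
  apply is_lim_seq_spec in Hlam. destruct (Hlam (mkposreal _ Hd)) as [k1 Hk1]. simpl in Hk1.
  (* beyond this point the bump below L has index at least S (k0 + k1), so
     both smallness conditions of the kernel estimate hold *)
  exists (N (S (k0 + k1))). intros L HL xi a b Hxi Ha Hb.
  destruct (locate N (S (k0 + k1)) L Sp (Rlt_le _ _ HL)) as [k' [Hk HLk]].
  destruct k' as [|k]; [lia|].
  assert (Nk := HN k). assert (Nk1 := Sp k).
  assert (Reg := bump_regime_potential W lam N w l I M k L Sp HN Hp HS Hw Hl HM HLk).
  assert (Hlk : 0 <= Rabs (lam (S k)) <= delta).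
  { split; [apply Rabs_pos|]. left. rewrite <- (Rminus_0_r (lam (S k))). apply Hk1. lia. }
  assert (Hth : smallness s0 r v (N k + 2) L <= delta).
  { apply (Hk0 k); [lia|lra|]. eapply Rle_trans; [now apply sparse_threshold|lra]. }
  set (s := sqrt xi). assert (Hxi0 := HKp xi Hxi).
  assert (Hs : s0 <= s) by (apply sqrt_le_1_alt; auto).
  assert (Hs2 : s ^ 2 = xi) by (apply pow2_sqrt; lra).
  assert (Hrho : PI * density xi = / (2 * s)).
  { unfold density. fold s. field. split; [lra|]. apply PI_neq0. }
  rewrite Hrho. rewrite <- Hs2 at 1 2 3 4.
  assert (Har : Cmod a <= r) by (unfold r; generalize (Hra a Ha); lra).
  assert (Hbr : Cmod b <= r) by (unfold r; generalize (Hrb b Hb); lra).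
  destruct (neumann_solution_extension _ _ _ (Hu (RtoC (s ^ 2)))) as [u0 [u01 [E0 [I0 [I01 Sol0]]]]].
  destruct (neumann_solution_extension _ _ _ (Hu (RtoC (s ^ 2) + a / RtoC L)%C)) as [ua [ua1 [Ea [Ia [Ia1 Sola]]]]].
  destruct (neumann_solution_extension _ _ _ (Hu (RtoC (s ^ 2) + b / RtoC L)%C)) as [ub [ub1 [Eb [Ib [Ib1 Solb]]]]].
  rewrite (CD_kernel_eq u L _ _ ua ub), (CD_kernel_eq u L _ _ u0 u0) by (easy || lra).
  assert (N0 : neumann (potential W lam N) (RtoC (s ^ 2)) L u0 u01) by easy.
  assert (LC : RtoC L <> 0) by (intros E; apply RtoC_inj in E; lra).
  assert (N0' : neumann (potential W lam N) (RtoC (s ^ 2) + 0 / RtoC L) L u0 u01).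
  { replace (RtoC (s ^ 2) + 0 / RtoC L)%C with (RtoC (s ^ 2)) by (field; easy). easy. }
  assert (Z0 : Cmod 0 <= r) by (rewrite Cmod_0; lra).
  destruct (Ker _ _ _ _ s a b u0 u01 ua ua1 ub ub1 Reg Hlk Hth Hs Har Hbr N0) as [MP KX]; try easy.
  destruct (Ker _ _ _ _ s 0 0 u0 u01 u0 u01 u0 u01 Reg Hlk Hth Hs Z0 Z0 N0 N0' N0') as [_ KY].
  replace (RtoC (/ (2 * s)) * (0 - 0))%C with (RtoC 0) in KY by ring.
  rewrite Csinc_0, Cmult_1_r in KY.
  apply Rle_lt_trans with (2 * eta * (1 + q)); [|lra].
  eapply ratio_estimate; [exact MP|lra| |exact KX|exact KY].
  now apply Csinc_bound.
Qed.
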